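(* Let $\mathbb{T}\subset\mathbb{R}$ be a time scale, let $a,b\in\mathbb{T}$ with $a<b$, and let $f:\mathbb{T}\to\mathbb{C}$ be a function with extension $\bar f:\mathbb{R}\to\mathbb{C}$. Then $f$ is delta absolutely continuous on $[a,b]_{\mathbb{T}}$ if and only if $\bar f$ is left continuous on $[a,b]$ and absolutely continuous with respect to $\sigma$ on $[a,b)$. In this case $$f^\Delta(t)=\frac{d\bar f}{d\sigma}(t)$$ for almost all $t\in[a,b)$ with respect to $\sigma$.
   Context: A time scale $\mathbb{T}$ is a nonempty closed subset of $\mathbb{R}$. The forward shift $\sigma:\mathbb{R}\to\mathbb{R}$ is defined by $\sigma(t)=\inf\{s\in\mathbb{T}: t<s\}$ if $t<\sup\mathbb{T}$ and $\sigma(t)=\sup\mathbb{T}$ if $t\ge\sup\mathbb{T}$. It is nondecreasing and right continuous. For a function $g:\mathbb{R}\to\mathbb{C}$ which is locally of bounded variation, write $g_\pm(t)=\lim_{\varepsilon\downarrow0}g(t\pm\varepsilon)$. Such a $g$ has an associated Borel measure, denoted by the same letter, with $g((x,y])=g_+(y)-g_+(x)$, $g([x,y])=g_+(y)-g_-(x)$, $g((x,y))=g_-(y)-g_+(x)$ and $g([x,y))=g_-(y)-g_-(x)$. In particular, $\sigma$ also denotes the Borel measure on $\mathbb{R}$ with distribution function $\sigma$. Write $[a,b]_{\mathbb{T}}=[a,b]\cap\mathbb{T}$. The extension $\bar f:\mathbb{R}\to\mathbb{C}$ of $f:\mathbb{T}\to\mathbb{C}$ is defined by $\bar f(t)=f(t)$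 for $t\in\mathbb{T}$ and $\bar f(t)=f(\sigma(t))$ for $t\notin\mathbb{T}$. A function $f:\mathbb{T}\to\mathbb{C}$ is delta absolutely continuous on $[a,b]_{\mathbb{T}}$ if for every $\varepsilon>0$ there is a $\delta>0$ such that whenever $\{[a_k,b_k)\cap\mathbb{T}\}_{k=1}^n$, with $a_k,b_k\in[a,b]_{\mathbb{T}}$, is a finite pairwise disjoint family of subintervals of $[a,b]_{\mathbb{T}}$ with $\sum_{k=1}^n(b_k-a_k)<\delta$, then $\sum_{k=1}^n|f(b_k)-f(a_k)|<\varepsilon$. A function $f$ on $\mathbb{T}$ is delta (or Hilger) differentiable at $t\in\mathbb{T}$ if there is a number $f^\Delta(t)$ such that for every $\varepsilon>0$ there is a neighborhood $U\subset\mathbb{T}$ of $t$ with $|f(\sigma(t))-f(s)-f^\Delta(t)(\sigma(t)-s)|\le\varepsilon|\sigma(t)-s|$ for all $s\in U$. For $\nu:\mathbb{R}\to\mathbb{C}$ locally of bounded variation, $\frac{d\nu}{d\sigma}$ denotes the Radon--Nikodym derivative of the associated measure $\nu$ with respect to the measure $\sigma$. It is defined almost everywhere with respect to $\sigma$, and is given $\sigma$-almost everywhere by $$\frac{d\nu}{d\sigma}(t)=\lim_{\varepsilon\downarrow0}\frac{\nu((t-\varepsilon,t+\varepsilon))}{\sigma((t-\varepsilon,t+\varepsilon))}=\lim_{\varepsilon\downarrow0}\frac{\nu_-(t+\varepsilon)-\nu_+(t-\varepsilon)}{\sigma_-(t+\varepsilon)-\sigma_+(t-\varepsilon)}.$$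 Such a function $\nu$ is absolutely continuous with respect to $\sigma$ on $[a,b)$ if the associated measure, restricted to this interval, is absolutely continuous with respect to $\sigma$, i.e. if $$\nu_-(x)-\nu_-(a)=\int_{[a,x)}\frac{d\nu}{d\sigma}(t)\,d\sigma(t),\qquad x\in[a,b).$$
   Formalization: At the endpoint a, values of f left of a are ignored: left continuity is required only on (a,b], the measure uses f̄(a) for f̄₋(a), and f^Δ(a) is taken on [a,b]_T (on T if f̄ is left continuous at a). As stated it fails for T=R, f=1 on [0,∞), 0 elsewhere, [a,b]=[0,1]. *)

(* Defs.v *)
From HB Require Import structures.
From mathcomp Require Import all_boot all_order all_algebra.
From mathcomp Require Import complex.
From mathcomp Require Import all_classical all_reals all_analysis.

Set Implicit Arguments.
Unset Strict Implicit.
Unset Printing Implicit Defensive.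
Import Order.TTheory GRing.Theory Num.Theory.
Import numFieldNormedType.Exports.

Local Open Scope classical_set_scope.
Local Open Scope ring_scope.
Local Open Scope complex_scope.
Local Open Scope charge_scope.

Definition time_scale (R : realType) (T : set R) : Prop :=
  T !=set0 /\ closed T.

(* The supremum of T is taken in \bar R, as T need not be bounded above; the
   second branch is only reached when it is. *)
Definition fshift (R : realType) (T : set R) (t : R) : R :=
  if (t%:E < ereal_sup [set s%:E | s in T])%E
  then inf [set s | T s /\ t < s] else sup T.

Section fshift_cumulative.
Variables (R : realType) (T : set R).
Local Notation sg := (fshift T).

Lemma fshift_ltP (t : R) :
  reflect (exists2 s, T s & t < s)
    (t%:E < ereal_sup [set s%:E | s in T])%E.
Proof.
apply: (iffP idP) => [/ereal_sup_gt[_ [s Ts <-]]|[s Ts ts]].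
  by rewrite lte_fin => ts; exists s.
apply: (@lt_le_trans _ _ s%:E); first by rewrite lte_fin.
by apply: ereal_sup_ubound; exists s.
Qed.

Lemma fshift_le (t s : R) : T s -> t < s -> sg t <= s.
Proof.
move=> Ts ts; rewrite /fshift ifT; last by apply/fshift_ltP; exists s.
by apply: ge_inf; [exists t => x [_ /ltW]|].
Qed.

Lemma fshift_ge (t u : R) : (exists2 s, T s & t < s) ->
  (forall s, T s -> t < s -> u <= s) -> u <= sg t.
Proof.
move=> [s Ts ts] h; rewrite /fshift ifT; last by apply/fshift_ltP; exists s.
by apply: lb_le_inf; [exists s|move=> x [Tx tx]; exact: h].
Qed.

Lemma fshift_sup (t : R) : ~ (exists2 s, T s & t < s) -> sg t = sup T.
Proof. by move=> h; rewrite /fshift ifF//; apply/fshift_ltP. Qed.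

Lemma fshift_nd : nondecreasing sg.
Proof.
move=> x y xy.
have [hy|hy] := pselect (exists2 s, T s & y < s).
  apply: fshift_ge => // s Ts ys; apply: fshift_le => //.
  exact: le_lt_trans ys.
rewrite (fshift_sup hy).
have [hx|hx] := pselect (exists2 s, T s & x < s); last by rewrite fshift_sup.
have [s Ts xs] := hx.
apply: (le_trans (fshift_le Ts xs)); apply: ub_le_sup => //.
by exists y => z Tz; rewrite leNgt; apply/negP => yz; apply: hy; exists z.
Qed.

Lemma fshift_rc : right_continuous sg.
Proof.
move=> x; apply/cvgrPdist_le => e e0.
have [hx|hx] := pselect (exists2 s, T s & x < s); last first.
  near=> y; rewrite (fshift_sup hx) fshift_sup ?subrr ?normr0 ?ltW//.
  move=> [s Ts ys]; apply: hx; exists s => //; apply: lt_trans ys.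
  by near: y; exact: nbhs_right_gt.
have [s [Ts xs] se] : exists2 s, T s /\ x < s & s < sg x + e.
  have inf_x : has_inf [set s | T s /\ x < s].
    by split; [case: hx => s; exists s|exists x => z [_ /ltW]].
  have := @inf_adherent _ _ e e0 inf_x.
  by rewrite /fshift ifT//; apply/fshift_ltP.
near=> y.
have xy : x < y by near: y; exact: nbhs_right_gt.
have ys : y < s by near: y; exact: nbhs_right_lt.
rewrite distrC ger0_norm; last by rewrite subr_ge0 fshift_nd// ltW.
rewrite lerBlDl.
by rewrite (le_trans (fshift_le Ts ys))// ltW.
Unshelve. all: by end_near. Qed.

HB.instance Definition _ := isCumulative.Build R _ R sg fshift_nd fshift_rc.
End fshift_cumulative.

(* The Borel measure with distribution function sigma. *)
Definition fshift_measure (R : realType) (T : set R) :=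
  lebesgue_stieltjes_measure (fshift T).

(* A function on T is a function on R whose values outside T are irrelevant;
   fshift T t belongs to T since T is closed, so `extension T f` only depends
   on the restriction of f to T. *)
Definition extension (R : realType) (T : set R) (f : R -> R[i]) (t : R) :
    R[i] :=
  if `[< T t >] then f t else f (fshift T t).

Definition delta_abs_continuous (R : realType) (T : set R)
    (f : R -> R[i]) (a b : R) : Prop :=
  forall e : R, 0 < e -> exists2 d : R, 0 < d &
    forall (n : nat) (ak bk : 'I_n -> R),
      (forall k, [/\ T (ak k), T (bk k), a <= ak k, ak k <= bk k & bk k <= b]) ->
      trivIset setT (fun k => `[ak k, bk k[ `&` T) ->
      \sum_(k < n) (bk k - ak k) < d ->
      \sum_(k < n) Normc.normc (f (bk k) - f (ak k)) < e.

(* D is the set of points admitted near t: with D = T this is delta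
   differentiability on T, with D = T `&` `[a, b] it is delta differentiability
   on the time scale [a, b]_T, whose forward shift agrees with that of T
   on [a, b[. *)
Definition is_delta_derivative_within (R : realType) (T : set R)
    (D : set R) (f : R -> R[i]) (t : R) (l : R[i]) : Prop :=
  D t /\ forall e : R, 0 < e -> \forall s \near within D (nbhs t),
    Normc.normc (f (fshift T t) - f s - l * (fshift T t - s)%:C)
      <= e * `|fshift T t - s|.

Definition is_delta_derivative (R : realType) (T : set R) :=
  is_delta_derivative_within T T.

Definition left_continuous_at (R : realType) (g : R -> R[i]) (t : R) : Prop :=
  (g x : R[i]^o) @[x --> t^'-] --> (g t : R[i]^o).

(* Left continuity of the restriction of g to [a, b]: nothing is required at a.
   A requirement at a would involve values of f to the left of a, which
   are unrelated to f on [a, b]_T when a is left-dense in T. *)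
Definition left_continuous_on (R : realType) (g : R -> R[i]) (a b : R) : Prop :=
  forall t, a < t -> t <= b -> left_continuous_at g t.

Definition rlim (R : realType) (g : R -> R) (t : R) : R :=
  lim (g x @[x --> t^'+]).

Definition llim (R : realType) (g : R -> R) (t : R) : R :=
  lim (g x @[x --> t^'-]).

Notation borel_charge R := ({charge set (measurableTypeR R) -> \bar R}).

Definition is_stieltjes_charge (R : realType) (g : R -> R)
    (nu : borel_charge R) : Prop :=
  forall x y : R, x < y ->
    [/\ nu `]x, y]%classic = (rlim g y - rlim g x)%:E,
        nu `[x, y]%classic = (rlim g y - llim g x)%:E,
        nu `]x, y[%classic = (llim g y - rlim g x)%:E &
        nu `[x, y[%classic = (llim g y - llim g x)%:E].

(* A complex Borel measure, given by its real and imaginary parts. *)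
Definition complex_charge (R : realType) : Type :=
  (borel_charge R * borel_charge R)%type.

(* The function that agrees with g on [a, b] and is constant on either side:
   its one-sided limits are those of g restricted to [a, b], with
   g_-(a) = g(a) and g_+(b) = g(b). *)
Definition clamp (R : realType) (a b : R) (g : R -> R[i]) (x : R) : R[i] :=
  g (Num.max a (Num.min x b)).

Definition bounded_variation_on (R : realType) (a b : R) (g : R -> R[i]) :
    Prop :=
  bounded_variation a b (@complex.Re R \o g) /\
  bounded_variation a b (@complex.Im R \o g).

Definition is_assoc_measure (R : realType) (a b : R) (g : R -> R[i])
    (nu : complex_charge R) : Prop :=
  is_stieltjes_charge (@complex.Re R \o clamp a b g) nu.1 /\
  is_stieltjes_charge (@complex.Im R \o clamp a b g) nu.2.

Definition co_restr (R : realType) (a b : R) (nu : borel_charge R) :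
    borel_charge R :=
  crestr0 nu (measurable_itv `[a, b[).

(* Bounded variation on [a, b] is what gives g a measure on [a, b[; it is part
   of the notion because an arbitrary f is not assumed to have it. *)
Definition abs_continuous_fshift (R : realType) (T : set R)
    (g : R -> R[i]) (a b : R) : Prop :=
  bounded_variation_on a b g /\
  exists2 nu : complex_charge R, is_assoc_measure a b g nu &
    co_restr a b nu.1 `<< fshift_measure T /\
    co_restr a b nu.2 `<< fshift_measure T.

(* The Radon-Nikodym derivative on [a, b[ with respect to sigma. *)
Definition RN_derivative (R : realType) (T : set R) (a b : R)
    (nu : complex_charge R) (t : R) : R[i] :=
  fine (('d (co_restr a b nu.1) '/d (fshift_measure T)) t) +i*
  fine (('d (co_restr a b nu.2) '/d (fshift_measure T)) t).

(* Main.v *)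
Require Import Defs.
From HB Require Import structures.
From mathcomp Require Import all_boot all_order all_algebra.
From mathcomp Require Import complex.
From mathcomp Require Import all_classical all_reals all_analysis.
From mathcomp Require Import ring lra measurable_realfun.

Set Implicit Arguments.
Unset Strict Implicit.
Unset Printing Implicit Defensive.
Import Order.TTheory GRing.Theory Num.Theory.
Import numFieldNormedType.Exports.

(** Rounding up into T turns the time scale statement into a statement about
the real line. Let c round a real number up to the nearest point of
T between a and b (tround); it is nondecreasing, left-continuous on ]a, b],
fixes the points of T between a and b, and the extension of f, clamped to
[a, b], is f o c. The measure of a cell [s, t[ with endpoints in T is t - s
(fshift_measure_co). Hence delta absolute continuity of f says that the
increments of f o c are controlled by the measures of the corresponding
intervals, which is the epsilon-delta form of absolute continuity of measures.

From functions to measures. If f is delta absolutely continuous, f o c has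
bounded variation (delta_ac_bv), so it is a difference of nondecreasing
functions and defines a charge nu (bv_stieltjes_charge). The epsilon-delta
estimate passes to finite disjoint unions of half-open intervals
(delta_ac_ring). For a bounded interval J, the sets A such that sigma(A `&` J) < d
implies |nu(A `&` J)| <= e form a monotone class, so the estimate holds for all
Borel sets, and sigma-null subsets of [a, b[ are nu-null (delta_ac_dominates).
Conversely, a charge dominated by sigma satisfies an epsilon-delta condition,
and left continuity of f o c identifies nu([s, t[) with f(t) - f(s)
(dominated_delta_ac).

The derivative. Let rho round down into T (tdown). The measure sigma is the
image under rho of Lebesgue measure on the interval from inf T to sup T
(fshift_measureE). With phi the density of nu, this gives
f(s) - f(a) = F(s) for s in T between a and b, where F is the
indefinite Lebesgue integral of phi o rho on [a, b[. At a right-scattered t the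
map rho is constant on [t, sigma(t)[, so phi(t) is exactly the difference quotient
(scattered_derivative). At almost every right-dense t the Lebesgue
differentiation theorem gives F'(t) = phi(t), and f differs from F by a
constant on T. The exceptional points are right-dense or outside T, where
rho-preimages do not enlarge Lebesgue-null sets, so they form a sigma-null set
(delta_derivative_ae). Everything is proved for real functions and applied to
the real and imaginary parts. *)

Local Open Scope classical_set_scope.
Local Open Scope ring_scope.

(** * Rounding onto a time scale *)

Definition tceil (R : realType) (T : set R) (t : R) : R :=
  if `[< T t >] then t else fshift T t.

Definition tfloor (R : realType) (T : set R) (t : R) : R :=
  sup [set s | T s /\ s <= t].

Section geometry.
Variables (R : realType) (T : set R).
Hypothesis hT : time_scale T.
Local Notation sg := (fshift T).

Lemma fshift_gt_mem (t s : R) : T s -> t < s -> T (sg t) /\ t <= sg t.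
Proof.
move=> Ts ts.
have hi : has_inf [set x | T x /\ t < x].
  by split; [exists s|exists t => z [_ /ltW]].
have sgE : sg t = inf [set x | T x /\ t < x].
  by rewrite /fshift ifT//; apply/fshift_ltP; exists s.
split; last by apply: fshift_ge => [|u _ /ltW//]; exists s.
have [_ cT] := hT; apply: cT => B /nbhs_ballP[e /= e0 eB].
have [u [Tu tu] ue] := inf_adherent e0 hi.
exists u; split => //; apply: eB; rewrite /ball/= sgE distrC ger0_norm.
  by rewrite ltrBlDl.
by rewrite subr_ge0; apply: ge_inf; [case: hi|].
Qed.

Lemma fshift_ge_min (t s : R) : T s -> t <= s -> t <= sg t.
Proof.
move=> Ts; rewrite le_eqVlt => /predU1P[->|ts]; last first.
  by have [] := fshift_gt_mem Ts ts.
have [[u Tu su]|h] := pselect (exists2 u, T u & s < u).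
  by have [] := fshift_gt_mem Tu su.
rewrite fshift_sup//; apply: ub_le_sup => //.
by exists s => z Tz; rewrite leNgt; apply/negP => sz; apply: h; exists z.
Qed.

(** Beyond sup T the shift has the constant value sup T, which may lie below t
but not below a point of T. *)
Lemma fshift_ge_mem (t s : R) : T s -> s <= t -> s <= sg t.
Proof. by move=> Ts st; apply: le_trans (fshift_nd T st); exact: fshift_ge_min Ts _. Qed.

Lemma tceil_id t : T t -> tceil T t = t.
Proof. by move=> Tt; rewrite /tceil ifT//; apply/asboolP. Qed.

Lemma tceil_mem (t s : R) : T s -> t <= s -> T (tceil T t) /\ t <= tceil T t <= s.
Proof.
move=> Ts ts; rewrite /tceil; case: asboolP => Tt; first by rewrite lexx ts.
have lts : t < s.
  by rewrite lt_neqAle ts andbT; apply/eqP => e; apply: Tt; rewrite e.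
by have [? ->] := fshift_gt_mem Ts lts; rewrite fshift_le.
Qed.

Lemma tceil_le_fshift (t s : R) : T s -> t <= s -> tceil T t <= sg t.
Proof.
move=> Ts ts; rewrite /tceil; case: asboolP => //.
by move=> _; exact: fshift_ge_min ts.
Qed.

Lemma fshift_le_tceil (x y s : R) : T s -> x < y -> y <= s -> sg x <= tceil T y.
Proof.
by move=> Ts xy ys; have [? /andP[]] := tceil_mem Ts ys => yc _;
  apply: fshift_le => //; exact: lt_le_trans yc.
Qed.

Lemma tfloor_mem (t s : R) : T s -> s <= t ->
  [/\ T (tfloor T t), tfloor T t <= t & s <= tfloor T t].
Proof.
move=> Ts st; have hs : has_sup [set x | T x /\ x <= t].
  by split; [exists s|exists t => z []].
split.
- have [_ cT] := hT; apply: cT => B /nbhs_ballP[e /= e0 eB].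
  have [u [Tu ut] ue] := sup_adherent e0 hs.
  exists u; split => //; apply: eB; rewrite /ball/= ger0_norm.
    by rewrite ltrBlDl -ltrBlDr.
  by rewrite subr_ge0; apply: ub_le_sup; [case: hs|].
- by apply: ge_sup; [exists s|move=> z []].
- by apply: ub_le_sup; [case: hs|].
Qed.

Lemma tfloor_id t : T t -> tfloor T t = t.
Proof.
by move=> Tt; have [_ h1 h2] := tfloor_mem Tt (lexx t); apply/eqP; rewrite eq_le h1.
Qed.

Lemma le_tfloor (t s : R) : T s -> s <= t -> s <= tfloor T t.
Proof. by move=> Ts st; have [] := tfloor_mem Ts st. Qed.

Section round.
Variables a b : R.
Hypotheses (Ta : T a) (Tb : T b) (ab : a < b).

(** Clamping to [a, b] before rounding makes the result a point of T between a
and b for every real argument, and makes f \o tround the clamped extension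
of f. *)
Definition tround (x : R) : R := tceil T (Num.max a (Num.min x b)).

Lemma clamp_itv x : a <= Num.max a (Num.min x b) <= b.
Proof. by rewrite le_max lexx/= ge_max ge_min lexx orbT (ltW ab). Qed.

Lemma tround_mem x : [/\ T (tround x), a <= tround x & tround x <= b].
Proof.
have /andP[h1 h2] := clamp_itv x.
have [h3 /andP[h4 h5]] := tceil_mem Tb h2; split => //.
exact: le_trans h4.
Qed.

Lemma tround_in x : a <= x -> x <= b -> tround x = tceil T x.
Proof. by move=> ax xb; rewrite /tround (min_l xb) (max_r ax). Qed.

Lemma tround_id x : T x -> a <= x -> x <= b -> tround x = x.
Proof. by move=> Tx ax xb; rewrite tround_in// tceil_id. Qed.

Lemma tround_lo x : x <= a -> tround x = a.
Proof.
by move=> xa; rewrite /tround (min_l (le_trans xa (ltW ab))) max_l// tceil_id.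
Qed.

Lemma tround_hi x : b <= x -> tround x = b.
Proof. by move=> bx; rewrite /tround (min_r bx) max_r ?tceil_id// ltW. Qed.

Lemma tround_nd x y : x <= y -> tround x <= tround y.
Proof.
move=> xy; have [h1 h2 h3] := tround_mem y.
have /andP[_ h4] := clamp_itv y.
have h5 : Num.max a (Num.min x b) <= tround y.
  have [_ /andP[h6 _]] := tceil_mem Tb h4; apply: le_trans h6.
  rewrite ge_max le_max lexx /= le_max; apply/orP; right.
  by rewrite le_min !ge_min xy lexx orbT.
by have [_ /andP[_]] := tceil_mem h1 h5.
Qed.

Lemma tround_ge x : x <= b -> x <= tround x.
Proof.
move=> xb; have /andP[_ h4] := clamp_itv x.
have [_ /andP[h6 _]] := tceil_mem Tb h4; apply: le_trans h6.
by rewrite (min_l xb) le_max lexx orbT.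
Qed.

Lemma tround_le_mem x s : T s -> a <= s -> s <= b -> x <= s -> tround x <= s.
Proof. by move=> Ts as_ sb xs; rewrite -(tround_id Ts as_ sb) tround_nd. Qed.

(** The shift is the right-continuous version of the rounding, so an increment of
the rounding that starts strictly after x is at most the corresponding increment
of the shift. Clamping can only shorten increments. *)
Lemma troundB_le x x' y : x < x' -> x' <= y ->
  tround y - tround x' <= sg y - sg x.
Proof.
move=> xx' x'y.
have sxy : 0 <= sg y - sg x.
  by rewrite subr_ge0 fshift_nd// (le_trans (ltW xx')).
have [bx'|x'b] := leP b x'.
  by rewrite !tround_hi ?(le_trans bx')// subrr.
have [ya|ay] := leP y a.
  by rewrite !tround_lo ?(le_trans x'y)// subrr.
apply: lerB.
  have [by_|yb] := leP b y.
    by rewrite tround_hi//; exact: fshift_ge_mem.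
  rewrite tround_in ?(ltW ay) ?(ltW yb)//; apply: tceil_le_fshift Tb _; exact: ltW.
have [x'a|ax'] := leP x' a.
  by rewrite tround_lo//; apply: fshift_le => //; exact: lt_le_trans x'a.
rewrite tround_in ?(ltW ax') ?(ltW x'b)//.
by apply: fshift_le_tceil Tb _ _ => //; exact: ltW.
Qed.

End round.
End geometry.

(** * The measure of the forward shift as an image of Lebesgue measure *)

Lemma lebesgue_stieltjes_measure_oc (R : realType) (f : cumulative R R) (x y : R) :
  x <= y -> lebesgue_stieltjes_measure f `]x, y]%classic = (f y - f x)%:E.
Proof.
move=> xy; rewrite /lebesgue_stieltjes_measure /measure_extension.
rewrite measurable_mu_extE/=; last exact: is_ocitv.
by rewrite wlength_itv_bnd.
Qed.

Section pushforward.
Variables (R : realType) (T : set R).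
Hypothesis hT : time_scale T.
Local Notation sg := (fshift T).
Local Notation mu := (fshift_measure T).
Local Notation la := (@lebesgue_measure R).

(** The interval from inf T to sup T: rounding down is defined, and a later point
of T exists. It contains inf T if T is bounded below, and never contains
sup T. *)
Definition tcore : set R :=
  [set u | (exists2 s, T s & s <= u) /\ (exists2 s, T s & u < s)].

(** Outside the core the identity is a harmless value that keeps the map
nondecreasing, hence Borel, on the whole line. *)
Definition tdown (u : R) : R := if `[< tcore u >] then tfloor T u else u.

Lemma measurable_tcore : measurable (tcore : set (measurableTypeR R)).
Proof.
apply: is_interval_measurable => x y [[s Ts sx] _] [_ [t Tt yt]] z /andP[xz zy].
by split; [exists s => //; exact: le_trans xz|exists t => //; exact: le_lt_trans yt].
Qed.

Lemma tdown_core u : tcore u -> [/\ T (tdown u), tdown u <= u &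
  forall s, T s -> s <= u -> s <= tdown u].
Proof.
move=> Du; rewrite /tdown ifT; last exact/asboolP.
have [[s Ts su] _] := Du.
have [h1 h2 _] := tfloor_mem hT Ts su; split => // t Tt tu.
exact: le_tfloor.
Qed.

Lemma tdown_le u : tdown u <= u.
Proof.
have [/tdown_core[]//|h] := pselect (tcore u).
by rewrite /tdown ifF//; apply/asboolP.
Qed.

Lemma tdown_nd : nondecreasing tdown.
Proof.
move=> x y xy.
have [Dy|Dy] := pselect (tcore y); last first.
  by rewrite {2}/tdown ifF; [exact: le_trans (tdown_le x) xy|exact/asboolP].
have [Ty yy maxy] := tdown_core Dy.
have [Dx|Dx] := pselect (tcore x).
  have [Tx xx _] := tdown_core Dx; apply: maxy => //; exact: le_trans xy.
rewrite {1}/tdown ifF; last exact/asboolP.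
have [s Ts sy] := Dy.1; have [t Tt yt] := Dy.2.
have xs : x < s.
  rewrite ltNge; apply/negP => sx; apply: Dx; split; first by exists s.
  by exists t => //; exact: le_lt_trans yt.
by apply: (le_trans (ltW xs)); exact: maxy.
Qed.

Lemma measurable_tdown :
  measurable_fun setT (tdown : measurableTypeR R -> measurableTypeR R).
Proof. by apply: nondecreasing_measurable => //; exact: tdown_nd. Qed.

(** This lemma and the next say that, up to an endpoint, u rounds down to
at most y exactly when u precedes the next point of T after y. The endpoint
u = sg y is ambiguous when y is right-dense. *)
Lemma tdown_le_of_lt_fshift u y : tcore u -> u < sg y -> tdown u <= y.
Proof.
move=> Du uy; have [Td du _] := tdown_core Du; rewrite leNgt; apply/negP => yd.
by have := lt_le_trans uy (fshift_le Td yd); rewrite ltNge du.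
Qed.

Lemma le_fshift_of_tdown_le u y : tcore u -> tdown u <= y -> u <= sg y.
Proof.
move=> Du dy; have [Td du maxu] := tdown_core Du; have [t Tt ut] := Du.2.
have [ty|yt] := leP t y.
  by apply: le_trans (ltW ut) _; exact: fshift_ge_mem Tt ty.
have hi : has_inf [set x | T x /\ y < x].
  by split; [exists t|exists y => z [_ /ltW]].
have sgE : sg y = inf [set x | T x /\ y < x].
  by rewrite /fshift ifT//; apply/fshift_ltP; exists t.
rewrite leNgt; apply/negP => sgu.
have [v [Tv yv] vu] : exists2 v, T v /\ y < v & v < u.
  have du0 : 0 < u - sg y by rewrite subr_gt0.
  have [v h] := inf_adherent du0 hi; rewrite -sgE subrKC => vu.
  by exists v.
by have := le_lt_trans (le_trans (maxu _ Tv (ltW vu)) dy) yv; rewrite ltxx.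
Qed.

(** By uniqueness of Stieltjes measures it suffices to compare half-open
intervals. The preimage of ]x, y] lies between the open and the closed interval
from sg x to sg y, and both have length sg y - sg x. *)
Lemma fshift_measureE (A : set (measurableTypeR R)) : measurable A ->
  mu A = la (tcore `&` tdown @^-1` A).
Proof.
move=> mA; rewrite setIC.
pose nu0 : {measure set (measurableTypeR R) -> \bar R} :=
  pushforward (mrestr la measurable_tcore)
    (tdown : measurableTypeR R -> measurableTypeR R).
pose nu := nu0 measurable_tdown.
rewrite -[RHS]/(nu A); apply: lebesgue_stieltjes_measure_unique => //.
move=> X [[x y] _ <-] /=.
have [xy|yx] := leP y x.
  have -> : `]x, y]%classic = set0.
    by apply/seteqP; split => z //=; rewrite in_itv/= => /andP[/lt_le_trans h /h]; rewrite ltNge xy.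
  by rewrite measure0 [RHS](measure0 nu).
rewrite lebesgue_stieltjes_measure_oc ?(ltW yx)//.
rewrite /nu /= /pushforward /mrestr.
set P := _ `&` _.
have mP : measurable (P : set (measurableTypeR R)).
  apply: measurableI; last exact: measurable_tcore.
  by rewrite -[X in measurable X]setTI; apply: measurable_tdown.
have sxy : sg x <= sg y by rewrite fshift_nd// ltW.
(* P and the interval from sg x to sg y differ by at most the endpoints *)
have PS : P `<=` `[sg x, sg y].
  move=> u [/=]; rewrite in_itv/= => /andP[xu uy] Du; rewrite in_itv/=.
  rewrite le_fshift_of_tdown_le// andbT leNgt; apply/negP => ux.
  by have := tdown_le_of_lt_fshift Du ux; rewrite leNgt xu.
have SP : `]sg x, sg y[%classic `<=` P.
  move=> u; rewrite /= in_itv/= => /andP[xu uy].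
  have Du : tcore u.
    split; apply: contrapT => h.
      have xh : exists2 s, T s & x < s.
        have [s Ts] := hT.1; exists s => //; rewrite ltNge; apply/negP => sx.
        apply: h; exists s => //; apply: le_trans (ltW xu).
        exact: fshift_ge_mem Ts sx.
      have [s Ts xs] := xh.
      have [Tx _] := fshift_gt_mem hT Ts xs.
      by apply: h; exists (sg x) => //; exact: ltW.
    have [[s Ts ys]|h'] := pselect (exists2 s, T s & y < s).
      by apply: h; exists (sg y) => //; have [] := fshift_gt_mem hT Ts ys.
    move: uy; rewrite fshift_sup// ltNge => /negP; apply.
    apply: ge_sup; first exact: hT.1.
    by move=> z Tz; rewrite leNgt; apply/negP => uz; apply: h; exists z.
  split => //=; rewrite in_itv/= tdown_le_of_lt_fshift// andbT ltNge.
  by apply/negP => /(le_fshift_of_tdown_le Du); rewrite leNgt xu.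
apply/eqP; rewrite eq_le; apply/andP; split.
  rewrite (_ : (_ - _)%:E = la `]sg x, sg y[%classic); last first.
    rewrite lebesgue_measure_itv/= lte_fin; case: ltP => // h.
    by rewrite (@le_anti _ _ (sg x) (sg y)) ?subrr// sxy.
  by apply: le_measure => //; rewrite inE.
rewrite (_ : (_ - _)%:E = la `[sg x, sg y]%classic); last first.
  rewrite lebesgue_measure_itv/= lte_fin; case: ltP => // h.
  by rewrite (@le_anti _ _ (sg x) (sg y)) ?subrr// sxy.
by apply: le_measure => //; rewrite inE.
Qed.

(** Rounding down to a point of T does not leave a cell with endpoints in T. *)
Lemma tdown_preimage_co s t : T s -> T t ->
  tcore `&` tdown @^-1` `[s, t[%classic = `[s, t[%classic.
Proof.
move=> Ts Tt; apply/seteqP; split => u.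
  move=> [Du]; rewrite /= !in_itv/= => /andP[su ut].
  have [Td du maxu] := tdown_core Du.
  rewrite (le_trans su)//= ltNge; apply/negP => tu.
  by have := maxu _ Tt tu; rewrite leNgt ut.
rewrite /= in_itv/= => /andP[su ut].
have Du : tcore u by split; [exists s|exists t].
have [Td du maxu] := tdown_core Du.
by split => //; rewrite in_itv/= maxu//= (le_lt_trans du).
Qed.

Lemma fshift_measure_co s t : T s -> T t -> s <= t ->
  mu `[s, t[%classic = (t - s)%:E.
Proof.
move=> Ts Tt st; rewrite fshift_measureE// tdown_preimage_co//.
rewrite lebesgue_measure_itv/= lte_fin; case: ltP => // h.
by rewrite (@le_anti _ _ s t) ?subrr// st.
Qed.

(** Change of variables along the rounding, on a cell with endpoints in T. *)
Lemma integral_fshift_measure (g : measurableTypeR R -> \bar R) s t : T s -> T t ->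
  mu.-integrable setT g ->
  la.-integrable (`[s, t[%classic : set (measurableTypeR R)) (g \o tdown) /\
  (\int[mu]_(x in `[s, t[%classic) g x = \int[la]_(x in `[s, t[%classic) g (tdown x))%E.
Proof.
move=> Ts Tt ig.
have mg : measurable_fun setT g by exact: measurable_int ig.
have stD : `[s, t[%classic `<=` tcore.
  move=> u; rewrite /= in_itv/= => /andP[su ut].
  by split; [exists s|exists t].
have pre : (tdown @^-1` `[s, t[%classic) = `[s, t[%classic.
  rewrite -[RHS](tdown_preimage_co Ts Tt); apply/esym/setIidr => u.
  have [//|Du] := pselect (tcore u).
  by rewrite /= {1}/tdown ifF; [move=> /stD|exact/asboolP].
pose m := mrestr la measurable_tcore.
have lam (h : measurableTypeR R -> \bar R) :
    (\int[la]_(x in `[s, t[%classic) h x = \int[m]_(x in `[s, t[%classic) h x)%E.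
  apply: eq_measure_integral => A mA Ast; rewrite /m /= /mrestr setIidl//.
  exact: subset_trans stD.
pose pm0 : {measure set (measurableTypeR R) -> \bar R} :=
  pushforward m (tdown : measurableTypeR R -> measurableTypeR R).
have muE (h : measurableTypeR R -> \bar R) :
    (\int[mu]_(x in `[s, t[%classic) h x =
     \int[pushforward m (tdown : measurableTypeR R -> measurableTypeR R)]_(x in
       `[s, t[%classic) h x)%E.
  transitivity (\int[pm0 measurable_tdown]_(x in `[s, t[%classic) h x)%E; last by [].
  apply: eq_measure_integral => A mA Ast.
  by have := fshift_measureE mA; rewrite setIC.
have mgd : measurable_fun (setT : set (measurableTypeR R)) (g \o tdown).
  exact: (measurableT_comp mg measurable_tdown).
have intm : m.-integrable (`[s, t[%classic : set (measurableTypeR R)) (g \o tdown).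
  apply/integrableP; split; first exact: measurable_funTS.
  have : mu.-integrable (`[s, t[%classic : set (measurableTypeR R)) g.
    exact: (integrableS _ _ _ ig).
  move=> /integrableP[_].
  rewrite muE ge0_integral_pushforward//.
    by rewrite pre.
  exact: measurable_tdown.
  by apply: measurableT_comp => //; exact: measurable_funTS.
split.
  apply/integrableP; split; first exact: measurable_funTS.
  by rewrite lam; case/integrableP : intm.
rewrite muE integral_pushforward//.
- by rewrite pre lam.
- exact: measurable_tdown.
- by rewrite pre.
Qed.

End pushforward.

(** * Delta absolute continuity: bounded variation and left continuity *)

(** The real-valued analogue, applied below to real and imaginary parts. *)
Definition real_delta_abs_continuous (R : realType) (T : set R)
    (g : R -> R) (a b : R) : Prop :=
  forall e : R, 0 < e -> exists2 d : R, 0 < d &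
    forall (n : nat) (x y : 'I_n -> R),
      (forall k, [/\ T (x k), T (y k), a <= x k, x k <= y k & y k <= b]) ->
      trivIset setT (fun k => `[x k, y k[ `&` T) ->
      \sum_(k < n) (y k - x k) < d ->
      \sum_(k < n) `|g (y k) - g (x k)| < e.

Section delta_ac.
Variables (R : realType) (T : set R).
Hypothesis hT : time_scale T.
Variables a b : R.
Hypotheses (Ta : T a) (Tb : T b) (ab : a < b).
Local Notation sg := (fshift T).
Local Notation c := (tround T a b).
Variable g : R -> R.

(** Since the rounding is monotone, non-overlapping real intervals
round to disjoint cells, so the estimate may be used at arbitrary real
endpoints. *)
Lemma delta_ac_round : real_delta_abs_continuous T g a b ->
  forall e : R, 0 < e -> exists2 d : R, 0 < d &
    forall (n : nat) (x y : 'I_n -> R), (forall k, x k <= y k) ->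
      (forall j k, j != k -> y j <= x k \/ y k <= x j) ->
      \sum_(k < n) (c (y k) - c (x k)) < d ->
      \sum_(k < n) `|g (c (y k)) - g (c (x k))| < e.
Proof.
move=> ac e e0; have [d d0 H] := ac e e0; exists d => // n x y xy disj sd.
apply: (H n (c \o x) (c \o y)) => //.
  move=> k; have [h1 h2 h3] := tround_mem hT Tb ab (x k).
  have [h4 h5 h6] := tround_mem hT Tb ab (y k); split => //.
  exact: tround_nd.
apply/trivIsetP => j k _ _ jk; rewrite -subset0 => u [[]] /=.
rewrite !in_itv/= => /andP[ju uj] _ [/andP[ku uk] _].
case: (disj _ _ jk) => /(tround_nd hT Tb ab).
  by move=> /(lt_le_trans uj) /lt_le_trans /(_ ku); rewrite ltxx.
by move=> /(lt_le_trans uk) /lt_le_trans /(_ ju); rewrite ltxx.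
Qed.

(** On an interval whose rounded length is below the delta attached to epsilon = 1,
the cells of any partition form one admissible family, so every variation is
less than 1. *)
Lemma delta_ac_bv_small : real_delta_abs_continuous T g a b ->
  exists2 d : R, 0 < d & forall x y, x <= y -> c y - c x < d ->
    bounded_variation x y (g \o c).
Proof.
move=> /delta_ac_round /(_ 1 ltr01) [d d0 H]; exists d => // x y xy cxy.
exists 1 => _ [s [ps /eqP ls] <-]; apply: ltW.
have srt : sorted <%R (x :: s) by [].
pose F := nth y (x :: s).
have Fle i j : (i <= j)%N -> (j <= size s)%N -> F i <= F j.
  move=> ij js; apply: (sorted_leq_nth le_trans (lexx (T := _))) => //.
  - exact: (sub_sorted (@ltW _ _)).
  - by rewrite inE/= ltnS (leq_trans ij).
have -> : variation x y (g \o c) s =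
    \sum_(k < size s) `|g (c (F k.+1)) - g (c (F k))|.
  by rewrite /variation big_mkord.
apply: H => [k|j k jk|].
- by apply: Fle => //; exact: ltn_ord.
- have := jk; rewrite neq_ltn => /orP[|] h; [left|right]; by apply: Fle => //; exact/ltnW/ltn_ord.
- rewrite -(big_mkord xpredT (fun k => c (F k.+1) - c (F k))) telescope_sumr//.
  rewrite /F /=; suff -> : nth y (x :: s) (size s) = y by [].
  by rewrite -[RHS]ls (last_nth y).
Qed.

Lemma bounded_variation_cat x z y h : x <= z -> z <= y ->
  bounded_variation x z h -> bounded_variation z y h ->
  @bounded_variation R x y h.
Proof.
move=> xz zy /(bounded_variationP _ xz) h1 /(bounded_variationP _ zy) h2.
apply/(bounded_variationP _ (le_trans xz zy)).
by rewrite (total_variationD _ xz zy) fin_numD h1 h2.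
Qed.

Lemma tround_gap y t : T y -> a <= y -> y < t -> t <= sg y -> sg y <= b -> c t = sg y.
Proof.
move=> Ty ay yt ts sb.
have tb := le_trans ts sb; have at_ := le_trans ay (ltW yt).
rewrite tround_in//; apply/eqP; rewrite eq_le.
rewrite (fshift_le_tceil hT Tb) //andbT.
have [Ts _] := fshift_gt_mem hT Tb (lt_le_trans yt tb).
by have [_ /andP[]] := tceil_mem hT Ts ts.
Qed.

(** On a gap of T the rounded function takes only the value at the left end
and the value at the right end, so it is monotone. *)
Lemma bv_gap y : T y -> a <= y -> y < sg y -> sg y <= b ->
  bounded_variation y (sg y) (g \o c).
Proof.
move=> Ty ay ys sb.
have cy : c y = y by rewrite tround_id// (le_trans (ltW ys)).
have gapE t : y <= t -> t <= sg y -> (t == y) || (c t == sg y).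
  rewrite le_eqVlt => /predU1P[->|yt ts]; first by rewrite eqxx.
  by rewrite (tround_gap Ty)// eqxx orbT.
have css : c (sg y) = sg y by rewrite (tround_gap Ty).
have [h|h] := leP (g y) (g (sg y)).
  apply: nondecreasing_bounded_variation => t u.
  rewrite !in_itv/= => /andP[yt ts] /andP[yu us] tu.
  case/orP: (gapE _ yt ts) => /eqP ct; case/orP: (gapE _ yu us) => /eqP cu;
    rewrite /= ?ct ?cu ?cy ?lexx//.
  have ty : t = y by apply/eqP; rewrite eq_le yt -cu tu.
  by move: ys; rewrite -ct ty cy ltxx.
have -> : g \o c = \- (\- (g \o c)) by apply/funext => t /=; rewrite opprK.
apply: bounded_variationN.
apply: nondecreasing_bounded_variation => t u.
rewrite !in_itv/= => /andP[yt ts] /andP[yu us] tu; rewrite lerN2.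
case/orP: (gapE _ yt ts) => /eqP ct; case/orP: (gapE _ yu us) => /eqP cu;
  rewrite /= ?ct ?cu ?cy ?lexx ?(ltW h)//.
have ty : t = y by apply/eqP; rewrite eq_le yt -cu tu.
by move: ys; rewrite -ct ty cy ltxx.
Qed.

(** A jump of the rounding across a gap may exceed delta, so the interval cannot
simply be cut into short pieces. Starting from x in T, go to the last point y
of T within d / 2 of x, and then, unless y = b, to the shift of y, which is at
least d / 2 to the right of x. The variation is bounded on both pieces, and
finitely many such steps reach b. *)
Lemma delta_ac_bv : real_delta_abs_continuous T g a b ->
  bounded_variation a b (g \o c).
Proof.
move=> /delta_ac_bv_small[d d0 small].
suff H n x : T x -> a <= x -> x <= b -> b - x <= n%:R * (d / 2) ->
    bounded_variation x b (g \o c).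
  have d20 : 0 < d / 2 by rewrite divr_gt0.
  pose n := Num.truncn ((b - a) / (d / 2)).
  apply: (H n.+1) => //; first exact: ltW.
  rewrite -ler_pdivrMr//; apply: ltW.
  by rewrite truncnS_gt.
elim: n x => [|n ih] x Tx ax xb.
  rewrite mul0r subr_le0 => bx.
  have -> : x = b by apply/eqP; rewrite eq_le xb bx.
  exact: bounded_variationxx.
rewrite -natr1 mulrDl mul1r => hn.
pose v := Num.min (x + d / 2) b.
have xv : x <= v by rewrite /v le_min xb lerDl divr_ge0// ltW.
pose y := tfloor T v.
have [Ty yv xy] := tfloor_mem hT Tx xv.
rewrite -/y in Ty yv xy.
have yb : y <= b by rewrite (le_trans yv)// /v ge_min lexx orbT.
have ay : a <= y := le_trans ax xy.
have bv1 : bounded_variation x y (g \o c).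
  apply: small => //; rewrite !tround_id//.
  have : y <= x + d / 2 by rewrite (le_trans yv)// /v ge_min lexx.
  lra.
have := yb; rewrite le_eqVlt => /predU1P[yeb|ylb]; first by move: bv1; rewrite yeb.
have [Tz _] := fshift_gt_mem hT Tb ylb.
have zb : sg y <= b by rewrite fshift_le.
have vz : v <= sg y.
  apply: fshift_ge; first by exists b.
  move=> s Ts ys; rewrite leNgt; apply/negP => sv.
  by have := le_tfloor hT Ts (ltW sv); rewrite -/y leNgt ys.
have vE : v = x + d / 2.
  have [h|bv] := leP (x + d / 2) b; first by rewrite /v min_l.
  have : b <= y by rewrite /y /v min_r ?(ltW bv)//; exact: le_tfloor.
  by rewrite leNgt ylb.
have xz : x <= sg y := le_trans xv vz.
have yz : y <= sg y by have [] := fshift_gt_mem hT Tb ylb.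
apply: (bounded_variation_cat xz zb); last first.
  apply: ih => //; first exact: le_trans ax xz.
  by move: vz hn; rewrite vE; lra.
apply: (bounded_variation_cat xy yz bv1).
have := yz; rewrite le_eqVlt => /predU1P[<-|yltz]; first exact: bounded_variationxx.
exact: bv_gap.
Qed.

(** Near a point of T the rounding moves an argument x to the left of t by at most
t - x; near a point outside T it is constant. *)
Lemma delta_ac_left_continuous : real_delta_abs_continuous T g a b ->
  forall t, a < t -> t <= b -> (g \o c) x @[x --> t^'-] --> (g \o c) t.
Proof.
move=> ac t at_ tb; apply/cvgrPdist_lt => e e0.
have [d d0 H] := delta_ac_round ac e0.
(* a radius on the left of t free of points of T, when t is not in T *)
have [r r0 rT] : exists2 r : R, 0 < r & ~ T t -> forall z, t - r < z -> z < t -> ~ T z.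
  have [Tt|nTt] := pselect (T t); first by exists 1.
  have /nbhs_ballP[r /= r0 rT] : nbhs t (~` T).
    by apply: open_nbhs_nbhs; split => //; apply: closed_openC; exact: hT.2.
  exists r => // _ z rz zt; apply: rT; rewrite /ball/= ger0_norm; lra.
near=> x.
have ax : a < x by near: x; exact: nbhs_left_gt.
have xt : x < t by near: x; exact: nbhs_left_lt.
have := H 1%N (fun=> x) (fun=> t); rewrite !big_ord1; apply.
- by move=> _; exact: ltW.
- by move=> j k; rewrite !ord1 eqxx.
have [Tt|nTt] := pselect (T t).
  rewrite (tround_id Tt)//; last exact: ltW.
  have : x <= c x by rewrite tround_ge// (le_trans (ltW xt)).
  have : t - d < x by near: x; apply: nbhs_left_gt; lra.
  lra.
suff -> : c x = c t by rewrite subrr.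
have [Tcx acx cxb] := tround_mem hT Tb ab x.
apply/eqP; rewrite eq_le (tround_nd hT Tb ab (ltW xt))/=.
apply: (tround_le_mem hT Tb ab) => //.
have xcx : x <= c x by rewrite tround_ge// (le_trans (ltW xt)).
have [//|cxt] := leP t (c x); exfalso; move: Tcx.
apply: (rT nTt) => //; apply: lt_le_trans xcx.
by near: x; apply: nbhs_left_gt; lra.
Unshelve. all: by end_near. Qed.

End delta_ac.

(** * The charge of a function of bounded variation *)

Section monotone.
Variables (R : realType) (Q : R -> R).
Hypothesis Qnd : nondecreasing Q.

Lemma nd_is_cvg_right x : cvg (Q z @[z --> x^'+]).
Proof.
apply: nondecreasing_at_right_is_cvgr.
  by near=> y => u v _ _; exact: Qnd.
near=> y; exists (Q x) => _ [z /= + <-]; rewrite in_itv/= => /andP[xz _].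
by apply: Qnd; exact: ltW.
Unshelve. all: by end_near. Qed.

Lemma nd_is_cvg_left x : cvg (Q z @[z --> x^'-]).
Proof.
apply: nondecreasing_at_left_is_cvgr.
  by near=> y => u v _ _; exact: Qnd.
near=> y; exists (Q x) => _ [z /= + <-]; rewrite in_itv/= => /andP[_ zx].
by apply: Qnd; exact: ltW.
Unshelve. all: by end_near. Qed.

Lemma nd_le_rlim x : Q x <= rlim Q x.
Proof.
apply: limr_ge; first exact: nd_is_cvg_right.
by near=> z; apply: Qnd; near: z; exact: nbhs_right_ge.
Unshelve. all: by end_near. Qed.

Lemma rlim_le_nd x y : x < y -> rlim Q x <= Q y.
Proof.
move=> xy; apply: limr_le; first exact: nd_is_cvg_right.
by near=> z; apply: Qnd; near: z; exact: nbhs_right_le.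
Unshelve. all: by end_near. Qed.

Lemma nd_le_llim x y : x < y -> Q x <= llim Q y.
Proof.
move=> xy; apply: limr_ge; first exact: nd_is_cvg_left.
by near=> z; apply: Qnd; near: z; exact: nbhs_left_ge.
Unshelve. all: by end_near. Qed.

Lemma rlim_nd : nondecreasing (rlim Q).
Proof.
move=> x y; rewrite le_eqVlt => /predU1P[->//|xy].
exact: le_trans (rlim_le_nd xy) (nd_le_rlim y).
Qed.

Lemma rlim_rc : right_continuous (rlim Q).
Proof.
move=> x; apply/cvgrPdist_le => e e0.
have /cvgrPdist_le/(_ e e0) h := @nd_is_cvg_right x.
near x^'+ => y.
have xy : x < y by near: y; exact: nbhs_right_gt.
have Qy : `|rlim Q x - Q y| <= e by near: y; exact: h.
near=> z.
have xz : x < z by near: z; exact: nbhs_right_gt.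
have zy : z < y by near: z; exact: nbhs_right_lt.
have := rlim_nd (ltW xz); have := rlim_le_nd zy.
by move: Qy; rewrite !ler_norml; lra.
Unshelve. all: by end_near. Qed.

(** Regularising on the right does not change the limits from the left, so the
mass of a point is the full jump of Q there. *)
Lemma rlim_cvg_left x : rlim Q z @[z --> x^'-] --> llim Q x.
Proof.
apply/cvgrPdist_le => e e0.
have /cvgrPdist_le/(_ e e0) h := @nd_is_cvg_left x.
near x^'- => y.
have yx : y < x by near: y; exact: nbhs_left_lt.
have Qy : `|llim Q x - Q y| <= e by near: y; exact: h.
near=> z.
have zx : z < x by near: z; exact: nbhs_left_lt.
have yz : y < z by near: z; exact: nbhs_left_gt.
have zm : z < (z + x) / 2 by lra.
have mx : (z + x) / 2 < x by lra.
have := rlim_le_nd zm; have := nd_le_llim mx; have := Qnd (ltW yz).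
have := nd_le_rlim z.
by move: Qy; rewrite !ler_norml; lra.
Unshelve. all: by end_near. Qed.

(** The Stieltjes measure of the right-continuous version of Q; bounds on Q make
it finite, hence a charge. *)
Lemma nd_stieltjes_charge (l u : R) : (forall x, l <= Q x <= u) ->
  exists nu : borel_charge R,
    (forall x y, x <= y -> nu `]x, y]%classic = (rlim Q y - rlim Q x)%:E) /\
    (forall x : R, nu [set x] = (rlim Q x - llim Q x)%:E).
Proof.
move=> Qlu.
pose F : cumulative R R :=
  HB.pack (rlim Q) (isCumulative.Build R _ R (rlim Q) rlim_nd rlim_rc).
pose m := lebesgue_stieltjes_measure F.
have mE x y : x <= y -> m `]x, y]%classic = (rlim Q y - rlim Q x)%:E.
  exact: lebesgue_stieltjes_measure_oc.
have mfin : (m setT < +oo)%E.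
  apply: (@le_lt_trans _ _ (u - l)%:E); last exact: ltry.
  pose I n : set (measurableTypeR R) := `]- (n%:R), n%:R]%classic.
  have IT : \bigcup_n I n = setT by rewrite /I (bigcup_itvT false false).
  have cvgI : m (I n) @[n --> \oo] --> m (\bigcup_n I n).
    apply: nondecreasing_cvg_mu => //.
    - by move=> n; exact: measurable_itv.
    - by apply: bigcup_measurable => n _; exact: measurable_itv.
    - by move=> i j ij; apply/subsetPset/subset_itv; rewrite leBSide/= ?lerN2 ler_nat.
  rewrite -IT -(cvg_lim _ cvgI)//; apply: lime_le; first by apply/cvg_ex; eexists; exact: cvgI.
  near=> n; rewrite /I mE ?ge0_cp// lee_fin.
  apply: lerB.
    have /rlim_le_nd/le_trans : (n%:R < n%:R + 1 :> R) by rewrite ltrDl.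
    by apply; have /andP[] := Qlu (n%:R + 1).
  by apply: le_trans (nd_le_rlim _); have /andP[] := Qlu (- n%:R).
exists (charge_of_finite_measure (mfrestr measurableT mfin)).
split=> [x y xy|x].
  rewrite -[LHS]/(m (`]x, y]%classic `&` setT)) setIT.
  exact: mE.
rewrite -[LHS]/(m ([set x] `&` setT)) setIT.
pose I n : set (measurableTypeR R) := `](x - n.+1%:R^-1), x]%classic.
have mI n : measurable (I n) by exact: measurable_itv.
have <- : \bigcap_n I n = [set x] by rewrite set1_bigcap_oc.
have xn n : x - n.+1%:R^-1 <= x by rewrite gerBl invr_ge0.
have IE n : m (I n) = (rlim Q x - rlim Q (x - n.+1%:R^-1))%:E by rewrite /I mE.
have cvgI : m (I n) @[n --> \oo] --> m (\bigcap_n I n).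
  apply: nonincreasing_cvg_mu => //.
  - exact: (eq_ind_r (fun z => (z < +oo)%E) (ltry _) (IE 0%N)).
  - exact: bigcap_measurable.
  - move=> i j ij; apply/subsetPset/subset_itv; rewrite leBSide//= lerB// lef_pV2 ?posrE//.
    by rewrite ler_nat.
apply: (cvg_unique _ cvgI) => //.
rewrite (_ : (fun n => m (I n)) =
  EFin \o (fun n => rlim Q x - rlim Q (x - n.+1%:R^-1))); last first.
  by apply/funext => n; rewrite IE.
apply: cvg_EFin; first by near=> n.
apply: cvgB; first exact: cvg_cst.
have /cvg_at_leftP := @rlim_cvg_left x; apply; split.
  by move=> n; rewrite gtrBl invr_gt0.
rewrite -[X in _ --> X]subr0; apply: cvgB; first exact: cvg_cst.
exact: cvg_harmonic.
Unshelve. all: by end_near. Qed.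

End monotone.

Section bv.
Variable R : realType.

(** Half-open intervals and points determine the other kinds of intervals by
additivity. *)
Lemma is_stieltjes_charge_oc_set1 (h : R -> R) (nu : borel_charge R) :
  (forall x y, x < y -> nu `]x, y]%classic = (rlim h y - rlim h x)%:E) ->
  (forall x : R, nu [set x] = (rlim h x - llim h x)%:E) ->
  is_stieltjes_charge h nu.
Proof.
move=> hoc h1 x y xy.
have oo : nu `]x, y[%classic = (llim h y - rlim h x)%:E.
  have := hoc _ _ xy; rewrite -(@setUitv1 _ _ (BRight x) y true) ?bnd_simp//.
  rewrite chargeU//; last first.
    by apply/seteqP; split => z //= [+ zy]; rewrite zy in_itv/= ltxx andbF.
  rewrite h1 => /(congr1 (fun e => e - (rlim h y - llim h y)%:E)%E).
  rewrite addeK// -EFinB => ->; congr (_%:E); lra.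
split => //; first exact: hoc.
  rewrite -(@setU1itv _ _ (BRight y) x false) ?bnd_simp ?(ltW xy)//.
  rewrite chargeU//; last first.
    by apply/seteqP; split => z //= [->]; rewrite in_itv/= ltxx.
  by rewrite h1 hoc// -EFinD; congr (_%:E); lra.
rewrite -(@setU1itv _ _ (BLeft y) x false) ?bnd_simp//.
rewrite chargeU//; last first.
  by apply/seteqP; split => z //= [->]; rewrite in_itv/= ltxx.
by rewrite h1 oo -EFinD; congr (_%:E); lra.
Qed.

(** The positive and negative variations on [a, b], extended as constants. *)
Lemma bv_monotone_decomposition (a b : R) (h : R -> R) : a < b ->
  bounded_variation a b h -> (forall x, h x = h (Num.max a (Num.min x b))) ->
  exists P N : R -> R, [/\ nondecreasing P, nondecreasing N,
    exists l u, forall x, l <= P x <= u, exists l u, forall x, l <= N x <= u &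
    h = P \- N].
Proof.
move=> ab bv hE.
pose cl x := Num.max a (Num.min x b).
have clI x : cl x \in `[a, b].
  by rewrite in_itv/= le_max lexx/= ge_max ge_min lexx orbT (ltW ab).
have clnd : nondecreasing cl.
  move=> x y xy; rewrite ge_max le_max lexx /= le_max; apply/orP; right.
  by rewrite le_min !ge_min xy lexx orbT.
have aI : a \in `[a, b] by rewrite bound_itvE ltW.
have bI : b \in `[a, b] by rewrite bound_itvE ltW.
have bounds (F : R -> R) : {in `[a, b] &, nondecreasing_fun F} ->
    nondecreasing (F \o cl) /\ exists l u, forall x, l <= (F \o cl) x <= u.
  move=> Fnd; split; first by move=> x y xy; apply: Fnd => //; exact: clnd.
  exists (F a), (F b) => x; have := clI x; rewrite in_itv/= => /andP[h1 h2].
  by rewrite !Fnd.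
have [Pnd Pb] := bounds _ (fine_neg_tv_nondecreasing (bounded_variationN bv)).
have [Nnd Nb] := bounds _ (fine_neg_tv_nondecreasing bv).
exists ((fine \o pos_tv a h) \o cl), ((fine \o neg_tv a h) \o cl); split => //.
apply/funext => x; rewrite hE -/(cl x).
exact: (bounded_variation_pos_neg_tvE bv (clI x)).
Qed.

Lemma bv_is_cvg_right (a b : R) (h : R -> R) x : a < b ->
  bounded_variation a b h -> (forall x, h x = h (Num.max a (Num.min x b))) ->
  cvg (h z @[z --> x^'+]).
Proof.
move=> ab bv hE; have [P [N [Pnd Nnd _ _ ->]]] := bv_monotone_decomposition ab bv hE.
by apply: is_cvgB; exact: nd_is_cvg_right.
Qed.

Lemma bv_stieltjes_charge (a b : R) (h : R -> R) : a < b ->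
  bounded_variation a b h -> (forall x, h x = h (Num.max a (Num.min x b))) ->
  exists nu : borel_charge R, is_stieltjes_charge h nu.
Proof.
move=> ab bv hE; have [P [N [Pnd Nnd [l [u Plu]] [l' [u' Nlu]] hPN]]] :=
  bv_monotone_decomposition ab bv hE.
have [nP [nPoc nP1]] := nd_stieltjes_charge Pnd Plu.
have [nN [nNoc nN1]] := nd_stieltjes_charge Nnd Nlu.
exists (cadd nP (copp nN)).
have rE x : rlim h x = rlim P x - rlim N x.
  apply/cvg_lim => //; rewrite hPN.
  by apply: cvgB; exact: nd_is_cvg_right.
have lE x : llim h x = llim P x - llim N x.
  apply/cvg_lim => //; rewrite hPN.
  by apply: cvgB; exact: nd_is_cvg_left.
apply: is_stieltjes_charge_oc_set1 => [x y xy|x].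
  rewrite -[LHS]/(nP `]x, y]%classic - nN `]x, y]%classic)%E nPoc ?(ltW xy)// nNoc ?(ltW xy)//.
  by rewrite -EFinB !rE; congr (_%:E); lra.
rewrite -[LHS]/(nP [set x] - nN [set x])%E nP1 nN1.
by rewrite -EFinB rE lE; congr (_%:E); lra.
Qed.

End bv.

(** * From finite unions of intervals to Borel sets *)

(** Indexing by all of nat, with default the empty interval ]0, 0], suits the
additivity lemmas, which are about sequences of sets. *)
Definition nth_oc (R : realType) (s : seq (R * R)) (k : nat) : set R :=
  `](nth (0, 0) s k).1, (nth (0, 0) s k).2]%classic.

Section ring.
Variable R : realType.
Implicit Types s : seq (R * R).

Lemma nth_oc_default s k : (size s <= k)%N -> nth_oc s k = set0.
Proof.
move=> sk; rewrite /nth_oc nth_default//=.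
by apply/seteqP; split => z //=; rewrite in_itv/= => /andP[/lt_le_trans h /h]; rewrite ltxx.
Qed.

Lemma setring_ocitv_decomp (A : set R) : <<r @ocitv R >> A ->
  exists s, [/\ forall k, (k < size s)%N -> (nth (0, 0) s k).1 < (nth (0, 0) s k).2,
    trivIset setT (nth_oc s) & A = \big[setU/set0]_(k < size s) nth_oc s k].
Proof.
move=> rA.
have [->|/set0P A0] := eqVneq A set0.
  exists [::]; rewrite big_ord0; split => //.
  by apply/trivIsetP => i j _ _ _; rewrite nth_oc_default// set0I.
have /finite_seqP[s0 Bs] := SetRing.decomp_finite_set (A : set (SetRing.type (ocitv_type R))).
have pE (X : set R) : exists p : R * R, X \in s0 -> p.1 < p.2 /\ X = `]p.1, p.2]%classic.
  have [Xs|] := boolP (X \in s0); last by exists (0, 0).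
  have BX : X \in SetRing.decomp (A : set (SetRing.type (ocitv_type R))).
    by rewrite Bs inE.
  have : ocitv X by exact: SetRing.decomp_measurable BX.
  move=> /ocitvP[X0|[p p12 XE]]; last by exists p.
  by have := @SetRing.decomp_neq0 _ (ocitv_type R) A _ A0 BX; rewrite X0 => -[].
have [f fE] := choice pE.
pose s := map f (undup s0).
have nthE k : (k < size s)%N -> nth set0 (undup s0) k \in s0 /\
    nth_oc s k = nth set0 (undup s0) k /\ (nth (0, 0) s k).1 < (nth (0, 0) s k).2.
  rewrite size_map => ks.
  have h : nth set0 (undup s0) k \in s0 by rewrite -mem_undup mem_nth.
  by rewrite /nth_oc (nth_map set0)//; have [h1 <-] := fE _ h.
exists s; split.
- by move=> k /nthE[_ []].
- apply/trivIsetP => i j _ _ ij.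
  have [si|si] := leqP (size s) i; first by rewrite nth_oc_default// set0I.
  have [sj|sj] := leqP (size s) j; first by rewrite (nth_oc_default sj) setI0.
  have [i1 [-> _]] := nthE _ si; have [j1 [-> _]] := nthE _ sj.
  have := @SetRing.decomp_triv _ (ocitv_type R) A.
  move=> /trivIsetP; apply; rewrite ?Bs//=.
  by rewrite nth_uniq ?undup_uniq// -(size_map f).
- rewrite -[LHS](@SetRing.cover_decomp _ (ocitv_type R) A) Bs.
  rewrite -bigcup_mkord; apply/seteqP; split => z.
    move=> [X /= Xs Xz].
    have Xu : X \in undup s0 by rewrite mem_undup.
    have ks : (index X (undup s0) < size s)%N by rewrite size_map index_mem.
    exists (index X (undup s0)) => //.
    by have [_ [-> _]] := nthE _ ks; rewrite nth_index.
  move=> [k /= ks kz]; have [h1 [h2 _]] := nthE _ ks.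
  by exists (nth set0 (undup s0) k) => //; rewrite -h2.
Qed.

(** The monotone class theorem for the ring of half-open intervals. It yields a
sigma-ring, and the line is a countable union of half-open intervals. *)
Lemma ocitv_monotone_class (C : set (set R)) : monotone C ->
  <<r @ocitv R >> `<=` C -> (R.-ocitv.-measurable).-sigma.-measurable `<=` C.
Proof.
move=> mC rC.
apply: (@subset_trans _ <<sr <<r @ocitv R>> >>); last first.
  exact: monotone_setring_sub_g_sigma_ring.
have [G0 GD GU] := smallest_sigma_ring (<<r @ocitv R >>).
have oG : @ocitv R `<=` <<sr <<r @ocitv R>> >>.
  by apply: subset_trans (@sub_setring _ _) _; exact: sub_g_sigma_ring.
apply: smallest_sub => //; split => // A GA; apply: GD => //.
rewrite -(bigcup_itvT false false); apply: GU => n; apply: oG; exact: is_ocitv.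
Qed.

(** Continuity along monotone sequences holds for a charge because it is a
difference of two finite measures. *)
Lemma charge_nondecreasing_cvg (nu : borel_charge R) (F : (set R)^nat) :
  (forall n, measurable (F n : set (measurableTypeR R))) -> nondecreasing_seq F ->
  nu (F n) @[n --> \oo] --> nu (\bigcup_n F n).
Proof.
move=> mF ndF; have [P [N nuPN]] := Hahn_decomposition nu.
have mU : measurable (\bigcup_n F n : set (measurableTypeR R)) by exact: bigcupT_measurable.
have E A : measurable (A : set (measurableTypeR R)) ->
    nu A = (jordan_pos nuPN A - jordan_neg nuPN A)%E.
  by move=> mA; rewrite (jordan_decomp nuPN mA) /cadd/= cscaleN1.
rewrite E//; under eq_fun do rewrite E//.
apply: cvgeB.
- by rewrite fin_num_adde_defl// fin_numN fin_num_measure.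
- exact: nondecreasing_cvg_mu.
- exact: nondecreasing_cvg_mu.
Qed.

Lemma charge_nonincreasing_cvg (nu : borel_charge R) (F : (set R)^nat) :
  (forall n, measurable (F n : set (measurableTypeR R))) -> nonincreasing_seq F ->
  nu (F n) @[n --> \oo] --> nu (\bigcap_n F n).
Proof.
move=> mF ndF; have [P [N nuPN]] := Hahn_decomposition nu.
have mU : measurable (\bigcap_n F n : set (measurableTypeR R)) by exact: bigcapT_measurable.
have E A : measurable (A : set (measurableTypeR R)) ->
    nu A = (jordan_pos nuPN A - jordan_neg nuPN A)%E.
  by move=> mA; rewrite (jordan_decomp nuPN mA) /cadd/= cscaleN1.
rewrite E//; under eq_fun do rewrite E//.
apply: cvgeB.
- by rewrite fin_num_adde_defl// fin_numN fin_num_measure.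
- by apply: nonincreasing_cvg_mu => //; rewrite ltey_eq fin_num_measure.
- by apply: nonincreasing_cvg_mu => //; rewrite ltey_eq fin_num_measure.
Qed.

End ring.

(** * Delta absolute continuity implies domination *)

Lemma co_restrE (R : realType) (a b : R) (nu : borel_charge R) (A : set (measurableTypeR R)) :
  measurable A -> co_restr a b nu A = nu (A `&` `[a, b[).
Proof. by move=> mA; rewrite /co_restr/= /crestr0 mem_set. Qed.

Section dominated.
Variables (R : realType) (T : set R).
Hypothesis hT : time_scale T.
Variables a b : R.
Hypotheses (Ta : T a) (Tb : T b) (ab : a < b).
Local Notation sg := (fshift T).
Local Notation mu := (fshift_measure T).
Local Notation c := (tround T a b).
Variable g : R -> R.

Lemma tround_clamp x : c x = c (Num.max a (Num.min x b)).
Proof.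
have /andP[h1 h2] := clamp_itv ab x.
by rewrite {2}/tround (min_l h2) (max_r h1).
Qed.

Lemma measurable_nth_oc s k : measurable (nth_oc s k : set (measurableTypeR R)).
Proof. exact: measurable_itv. Qed.

(** The charge of ]x, y] involves the limits from the right of g \o c, which are
the limits of its values at points shifted to the right by 1 / (n + 1). Shifting all the
intervals by the same amount keeps them disjoint, and the shifted increments
of c are bounded by increments of the shift that converge to the measure
of the union. *)
Lemma delta_ac_ring (nu : borel_charge R) : real_delta_abs_continuous T g a b ->
  is_stieltjes_charge (g \o c) nu ->
  forall e : R, 0 < e -> exists2 d : R, 0 < d & forall A, <<r @ocitv R >> A ->
    (mu A < d%:E)%E -> (`|nu A| <= e%:E)%E.
Proof.
move=> ac stj e e0; have [d d0 H] := delta_ac_round hT Tb ab ac e0.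
exists d => // A /setring_ocitv_decomp[s [slt striv ->]].
pose x (k : nat) := (nth (0, 0) s k).1; pose y (k : nat) := (nth (0, 0) s k).2.
have mS : measurable (\big[setU/set0]_(k < size s) nth_oc s k : set (measurableTypeR R)).
  by apply: bigsetU_measurable => k _; exact: measurable_nth_oc.
have muE : mu (\big[setU/set0]_(k < size s) nth_oc s k) =
    (\sum_(k < size s) (sg (y k) - sg (x k)))%:E.
  rewrite [LHS](@measure_semi_additive _ _ _ (lebesgue_stieltjes_measure sg) _ (size s) _ striv mS).
    rewrite -sumEFin; apply: eq_bigr => k _.
    by apply: lebesgue_stieltjes_measure_oc; apply: ltW; exact: slt.
  exact: measurable_nth_oc.
rewrite [X in (X < _)%E]muE lte_fin => sd.
have bv := delta_ac_bv hT Ta Tb ab ac.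
have hc z : (g \o c) z = (g \o c) (Num.max a (Num.min z b)) by rewrite /= -tround_clamp.
have nuE : nu (\big[setU/set0]_(k < size s) nth_oc s k) =
    (\sum_(k < size s) (rlim (g \o c) (y k) - rlim (g \o c) (x k)))%:E.
  rewrite [LHS](@charge_semi_additive _ _ _ nu _ (size s) _ striv mS).
    rewrite -sumEFin; apply: eq_bigr => k _.
    by have [] := stj _ _ (slt k (ltn_ord k)).
  exact: measurable_nth_oc.
rewrite nuE abse_EFin lee_fin.
apply: le_trans (ler_norm_sum _ _ _) _.
have cvgh z : (g \o c) (z + n.+1%:R^-1) @[n --> \oo] --> rlim (g \o c) z.
  have /cvg_at_rightP := @bv_is_cvg_right _ _ _ _ z ab bv hc; apply; split.
    by move=> n; rewrite ltrDl invr_gt0.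
  rewrite -[X in _ --> X]addr0; apply: cvgD; first exact: cvg_cst.
  exact: cvg_harmonic.
have cvgs z : sg (z + n.+1%:R^-1) @[n --> \oo] --> sg z.
  have /cvg_at_rightP := @fshift_rc _ T z; apply; split.
    by move=> n; rewrite ltrDl invr_gt0.
  rewrite -[X in _ --> X]addr0; apply: cvgD; first exact: cvg_cst.
  exact: cvg_harmonic.
have c1 : \sum_(k < size s) `|(g \o c) (y k + n.+1%:R^-1) - (g \o c) (x k + n.+1%:R^-1)|
    @[n --> \oo] --> \sum_(k < size s) `|rlim (g \o c) (y k) - rlim (g \o c) (x k)|.
  by apply: cvg_big => [|k _]; [exact: add_continuous|apply: cvg_norm; apply: cvgB].
have c2 : \sum_(k < size s) (sg (y k + n.+1%:R^-1) - sg (x k))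
    @[n --> \oo] --> \sum_(k < size s) (sg (y k) - sg (x k)).
  by apply: cvg_big => [|k _]; [exact: add_continuous|apply: cvgB => //; exact: cvg_cst].
rewrite -(cvg_lim _ c1)//; apply: limr_le; first by apply/cvg_ex; eexists; exact: c1.
near=> n; apply/ltW.
apply: (H _ (fun k => x k + n.+1%:R^-1) (fun k => y k + n.+1%:R^-1)).
- by move=> k; rewrite lerD2r ltW//; exact: slt.
(* if neither interval precedes the other, the smaller right endpoint is common *)
- move=> j k jk; rewrite !lerD2r.
  have [h|xky] := leP (y j) (x k); [by left|right].
  have [//|xjy] := leP (y k) (x j).
  have /trivIsetP/(_ j k Logic.I Logic.I jk) := striv.
  move=> /seteqP[/(_ (Num.min (y j) (y k)))+ _]; case.
  have xyj := slt j (ltn_ord j); have xyk := slt k (ltn_ord k).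
  by split; rewrite /nth_oc/= in_itv/= lt_min ge_min lexx ?orbT ?andbT; apply/andP.
- apply: (@le_lt_trans _ _ (\sum_(k < size s) (sg (y k + n.+1%:R^-1) - sg (x k)))).
    apply: ler_sum => k _; apply: (troundB_le hT Ta Tb ab).
      by rewrite ltrDl invr_gt0.
    by rewrite lerD2r ltW//; exact: slt.
  by near: n; move/cvgr_lt: c2; apply.
Unshelve. all: by end_near. Qed.

(** Intersecting with a bounded half-open interval J makes the measure finite, as
continuity along decreasing sequences requires; J contains [a, b[. *)
Lemma delta_ac_dominates (nu : borel_charge R) : real_delta_abs_continuous T g a b ->
  is_stieltjes_charge (g \o c) nu -> co_restr a b nu `<< mu.
Proof.
move=> ac stj; apply/null_content_dominatesP => N mN muN.
rewrite co_restrE//.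
pose J : set (measurableTypeR R) := `]a - 1, b]%classic.
have mJ : measurable J by exact: measurable_itv.
have muJ : (mu J < +oo)%E.
  rewrite [X in (X < _)%E](_ : _ = (sg b - sg (a - 1))%:E) ?ltry//.
  by apply: lebesgue_stieltjes_measure_oc; rewrite lerBlDr (le_trans (ltW ab))// lerDl.
suff H e : 0 < e -> (`|nu (N `&` `[a, b[)| <= e%:E)%E.
  apply/eqP; rewrite -abse_eq0 eq_le abse_ge0 andbT.
  by apply/lee_addgt0Pr => e e0; rewrite add0e; exact: H.
move=> e0; have [d d0 Hr] := delta_ac_ring ac stj e0.
pose C : set (set R) := [set A | measurable (A : set (measurableTypeR R)) /\
  ((mu (A `&` J) < d%:E)%E -> (`|nu (A `&` J)| <= e%:E)%E)].
suff CN : (R.-ocitv.-measurable).-sigma.-measurable `<=` C.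
  have mNab : measurable (N `&` `[a, b[ : set (measurableTypeR R)).
    by apply: measurableI => //; exact: measurable_itv.
  have NJ : (N `&` `[a, b[) `&` J = N `&` `[a, b[.
    apply/setIidl => z [_]; rewrite /J/= !in_itv/= => /andP[az zb].
    by rewrite (ltW zb) andbT; lra.
  have [_] := CN _ mNab; rewrite NJ; apply.
  apply: le_lt_trans (_ : (0 < d%:E)%E); last by rewrite lte_fin.
  by rewrite -[leRHS]muN; apply: le_measure; rewrite ?inE.
apply: ocitv_monotone_class; last first.
  move=> A rA; split.
    apply: (@smallest_sub _ _ _ measurable) rA.
      split => [//|A1 B1|A1 B1]; [exact: measurableU|exact: measurableD].
    by move=> B [p _ <-]; exact: measurable_itv.
  apply: Hr.
  have -> : A `&` J = A `\` (A `\` J) by rewrite setDD.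
  apply: setringD => //; apply: setringD => //; apply: sub_setring; exact: is_ocitv.
split => F mono CF.
- have mF n : measurable (F n : set (measurableTypeR R)) by have [] := CF n.
  split; first exact: bigcupT_measurable.
  rewrite setI_bigcupl => muF.
  have : `|nu (F n `&` J)|%E @[n --> \oo] --> `|nu (\bigcup_n (F n `&` J))|%E.
    apply: cvg_abse; apply: (@charge_nondecreasing_cvg _ nu (fun n => F n `&` J)).
      by move=> n; exact: measurableI.
    by move=> i j ij; apply/subsetPset; apply: setSI; exact/subsetPset/mono.
  move=> h; rewrite -(cvg_lim _ h)//; apply: lime_le.
    by apply/cvg_ex; eexists; exact: h.
  near=> n; apply: (CF n).2; apply: le_lt_trans muF.
  apply: le_measure; rewrite ?inE; first exact: measurableI.
    by apply: bigcupT_measurable => k; exact: measurableI.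
  by move=> z Fz; exists n.
- have mF n : measurable (F n : set (measurableTypeR R)) by have [] := CF n.
  split; first exact: bigcapT_measurable.
  have IJ : (\bigcap_n F n) `&` J = \bigcap_n (F n `&` J).
    apply/seteqP; split => z.
      by move=> [Fz Jz] n _; split => //; exact: Fz.
    by move=> h; split=> [n _|]; [case: (h n Logic.I)|case: (h 0%N Logic.I)].
  rewrite IJ => muF.
  have ni : nonincreasing_seq (fun n => F n `&` J).
    by move=> i j ij; apply/subsetPset; apply: setSI; apply/subsetPset; exact: mono.
  have mFJ n : measurable (F n `&` J : set (measurableTypeR R)) by exact: measurableI.
  have h := @charge_nonincreasing_cvg _ nu (fun n => F n `&` J) mFJ ni.
  have h' : mu (F n `&` J) @[n --> \oo] --> mu (\bigcap_n (F n `&` J)).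
    apply: (@nonincreasing_cvg_mu _ _ _ (lebesgue_stieltjes_measure sg)) => //.
      apply: le_lt_trans muJ; apply: le_measure; rewrite ?inE//.
    exact: bigcapT_measurable.
  have [n0 n0d] : exists n0, (mu (F n0 `&` J) < d%:E)%E.
    apply: contrapT => /forallNP hn; move: muF; rewrite ltNge => /negP; apply.
    rewrite -(cvg_lim _ h')//; apply: lime_ge; first by apply/cvg_ex; eexists; exact: h'.
    by near=> n; rewrite leNgt; apply/negP; exact: hn.
  have {}h : `|nu (F n `&` J)|%E @[n --> \oo] --> `|nu (\bigcap_n (F n `&` J))|%E.
    exact: cvg_abse.
  rewrite -(cvg_lim _ h)//; apply: lime_le.
    by apply/cvg_ex; eexists; exact: h.
  near=> n; apply: (CF n).2; apply: le_lt_trans n0d.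
  apply: le_measure; rewrite ?inE//.
  by apply/subsetPset/ni; near: n; exact: nbhs_infty_ge.
Unshelve. all: by end_near. Qed.

End dominated.

(** * Domination implies delta absolute continuity *)

Section converse.
Variables (R : realType) (T : set R).
Hypothesis hT : time_scale T.
Variables a b : R.
Hypotheses (Ta : T a) (Tb : T b) (ab : a < b).
Local Notation sg := (fshift T).
Local Notation mu := (fshift_measure T).
Local Notation c := (tround T a b).
Variable g : R -> R.
Hypothesis lc : forall t, a < t -> t <= b -> (g \o c) x @[x --> t^'-] --> (g \o c) t.
Variable nu : borel_charge R.
Hypothesis stj : is_stieltjes_charge (g \o c) nu.

(** At a the limit from the left is that of the clamped function, which is
constant there. *)
Lemma llim_tround s : T s -> a <= s -> s <= b -> llim (g \o c) s = g s.
Proof.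
move=> Ts; rewrite le_eqVlt => /predU1P[<- _|as_ sb].
  apply/cvg_lim => //; apply: cvg_near_cst; near=> x.
  by rewrite /= tround_lo.
by rewrite -[in RHS](tround_id Ts (ltW as_) sb); apply/cvg_lim => //; exact: lc.
Unshelve. all: by end_near. Qed.

Lemma co_restr_co s t : T s -> T t -> a <= s -> s <= t -> t <= b ->
  co_restr a b nu `[s, t[%classic = (g t - g s)%:E.
Proof.
move=> Ts Tt as_ st tb; rewrite co_restrE; last exact: measurable_itv.
rewrite setIidl; last first.
  by move=> z; rewrite /= !in_itv/= => /andP[/(le_trans as_) -> /lt_le_trans ->].
move: st; rewrite le_eqVlt => /predU1P[->|st].
  rewrite subrr (_ : `[t, t[%classic = set0) ?charge0//.
  by apply/seteqP; split => z //=; rewrite in_itv/= => /andP[/le_lt_trans h /h]; rewrite ltxx.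
have [_ _ _ ->] := stj st.
by rewrite !llim_tround// ?(le_trans as_ (ltW st))// (le_trans (ltW st)).
Qed.

(** The cells of an admissible family are disjoint as real intervals, not only
on T, so their measures and total variations add up, and the epsilon-delta form
of domination applies to their union. *)
Lemma dominated_delta_ac : co_restr a b nu `<< mu -> real_delta_abs_continuous T g a b.
Proof.
move=> dom e e0.
have [P [N nuPN]] := Hahn_decomposition (co_restr a b nu).
have [d [d0 H]] := charge_variation_continuous nuPN dom e0.
exists d => // n x y xy triv sd.
pose F k : set (measurableTypeR R) := `[x k, y k[%classic.
have mF k : measurable (F k) by exact: measurable_itv.
(* the larger left endpoint of two overlapping cells belongs to T *)
have trivF : trivIset setT F.
  apply/trivIsetP => j k _ _ jk; rewrite -subset0 => z [].
  rewrite /F/= !in_itv/= => /andP[xj yj] /andP[xk yk].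
  have /trivIsetP/(_ j k Logic.I Logic.I jk)/seteqP[] := triv.
  move=> /(_ (Num.max (x j) (x k)))+ _; apply.
  have xm : T (Num.max (x j) (x k)).
    by have [Tj _ _ _ _] := xy j; have [Tk _ _ _ _] := xy k; case: leP.
  split; split => //; rewrite /= in_itv/= le_max lexx ?orbT/= gt_max;
    by rewrite (le_lt_trans xj) ?(le_lt_trans xk).
pose A := \big[setU/set0]_(k < n) F k.
have mA : measurable A by apply: bigsetU_measurable.
have muA : mu A = (\sum_(k < n) (y k - x k))%:E.
  rewrite [LHS](@measure_semi_additive_ord _ _ _ (lebesgue_stieltjes_measure sg) _ F)//.
  rewrite -sumEFin; apply: eq_bigr => k _; have [Tx Ty _ xyk _] := xy k.
  exact: fshift_measure_co.
have /H : measurable A by [].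
rewrite [X in (X < _)%E]muA lte_fin => /(_ sd); rewrite -lte_fin; apply: le_lt_trans.
rewrite [leRHS](@measure_semi_additive_ord _ _ _ (charge_variation nuPN) _ F)//.
rewrite -sumEFin; apply: lee_sum => k _.
apply: le_trans (abse_charge_variation nuPN (mF k)).
by have [Tx Ty ax xyk yb] := xy k; rewrite co_restr_co// abse_EFin.
Qed.

End converse.

(** * Differentiation *)

Lemma derivable_near_linear (R : realType) (F : R -> R) (t l : R) :
  derivable F t 1 -> derive1 F t = l -> forall e, 0 < e ->
  \forall s \near t, `|F t - F s - l * (t - s)| <= e * `|t - s|.
Proof.
move=> dF dl e e0.
have /is_derive1_caratheodory[q [qE qc qt]] : is_derive t 1 F l.
  by split => //; rewrite -derive1E.
have : q x @[x --> t] --> l by rewrite -qt.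
move=> /cvgrPdist_le/(_ e e0).
apply: filterS => s h.
have -> : F t - F s - l * (t - s) = (l - q s) * (s - t) * -1 * -1.
  by rewrite -(opprB (F s) (F t)) qE; ring.
by rewrite !mulrN1 opprK normrM (distrC t s) ler_wpM2r.
Qed.

Section derivative.
Variables (R : realType) (T : set R).
Hypothesis hT : time_scale T.
Variables a b : R.
Hypotheses (Ta : T a) (Tb : T b) (ab : a < b).
Local Notation sg := (fshift T).
Local Notation mu := (fshift_measure T).
Local Notation la := (@lebesgue_measure R).
Local Notation c := (tround T a b).
Variable g : R -> R.
Hypothesis lc : forall t, a < t -> t <= b -> (g \o c) x @[x --> t^'-] --> (g \o c) t.
Variable nu : borel_charge R.
Hypothesis stj : is_stieltjes_charge (g \o c) nu.
Hypothesis dom : co_restr a b nu `<< mu.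

Let phi : measurableTypeR R -> \bar R :=
  Radon_Nikodym (co_restr a b nu) (lebesgue_stieltjes_measure sg).

Let psi (u : R) : R := fine (phi (tdown T u)).

Let phi_int : mu.-integrable setT phi.
Proof. exact: Radon_Nikodym_integrable. Qed.

Let psiE u : (psi u)%:E = phi (tdown T u).
Proof. by rewrite fineK//; exact: Radon_Nikodym_fin_num. Qed.

Let psi_int : la.-integrable (`[a, b[%classic : set (measurableTypeR R)) (EFin \o psi).
Proof.
have [+ _] := integral_fshift_measure hT Ta Tb phi_int.
by apply: eq_integrable => // u _; rewrite /= psiE.
Qed.

Let increment s t : T s -> T t -> a <= s -> s <= t -> t <= b ->
  (g t - g s)%:E = (\int[la]_(x in `[s, t[%classic) (psi x)%:E)%E.
Proof.
move=> Ts Tt as_ st tb; rewrite -(co_restr_co Ta ab lc stj Ts Tt as_ st tb).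
rewrite (Radon_Nikodym_integral dom); last exact: measurable_itv.
have [_ ->] := integral_fshift_measure hT Ts Tt phi_int.
by apply: eq_integral => u _; rewrite psiE.
Qed.

(** The integral starts at minus infinity, with the integrand cut off outside
[a, b[, so that F is defined on both sides of a. *)
Let F (x : R) : R := \int[la]_(t in `]-oo, x]%classic) ((psi \_ `[a, b[%classic) t).

Let psi0_int : la.-integrable setT (EFin \o (psi \_ `[a, b[%classic)).
Proof.
rewrite -restrict_EFin.
have [+ _] := @integrable_mkcond _ (measurableTypeR R) R la `[a, b[%classic
  (EFin \o psi) (measurable_itv _).
by apply; exact: psi_int.
Qed.

Let incrementF s : T s -> a <= s -> s <= b -> g s - g a = F s.
Proof.
move=> Ts as_ sb; apply: EFin_inj; rewrite increment//.
rewrite /F /Rintegral fineK; last first.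
  by apply: integrable_fin_num => //; exact: integrableS psi0_int.
rewrite -[in RHS]integral_itv_bndo_bndc; last first.
  by apply: measurable_funTS; exact: measurable_int psi0_int.
under [in RHS]eq_integral => x _.
  rewrite (_ : _%:E = ((EFin \o psi) \_ `[a, b[%classic) x); last by rewrite restrict_EFin.
  over.
rewrite -integral_mkcondr; congr (integral _ _ _).
apply/seteqP; split => z; rewrite /= !in_itv/=.
  by move=> /andP[az zs]; split => //; rewrite az (lt_le_trans zs).
by move=> [zs /andP[-> _]].
Qed.

Let FTC : {ae la, forall x, derivable F x 1 /\ derive1 F x = (psi \_ `[a, b[%classic) x}.
Proof.
apply: FTC1Ny.
  by move=> y; exact: integrableS psi0_int.
exact: integrable_locally.
Qed.

(** The density is constant on [t, sg t[ after rounding down, so the increment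
of g across the gap is its value at t times the length of the gap. *)
Lemma scattered_derivative t : T t -> a <= t -> t < b -> t < sg t ->
  g (sg t) - g t = fine (phi t) * (sg t - t).
Proof.
move=> Tt at_ tb tst.
have [Ts _] := fshift_gt_mem hT Tb tb.
have sb : sg t <= b by rewrite fshift_le.
apply: EFin_inj; rewrite increment ?(ltW tst)//.
rewrite (eq_integral (fun _ => (psi t)%:E)); last first.
  move=> u; rewrite inE/= in_itv/= => /andP[tu us]; congr (_%:E).
  rewrite /psi; congr (fine (phi _)).
  have Du : tcore T u by split; [exists t|exists (sg t)].
  have Dt : tcore T t by split; [exists t|exists (sg t)].
  rewrite /tdown !ifT; [|exact/asboolP|exact/asboolP].
  rewrite (tfloor_id hT Tt); apply/eqP; rewrite eq_le le_tfloor// andbT.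
  have [Td du _] := tfloor_mem hT Tt tu.
  rewrite leNgt; apply/negP => td.
  by have := le_lt_trans (le_trans (fshift_le Td td) du) us; rewrite ltxx.
rewrite integral_cst//= lebesgue_measure_itv/= lte_fin tst -EFinB -EFinM.
rewrite /psi; congr (fine (phi _) * _)%:E.
have Dt : tcore T t by split; [exists t|exists (sg t)].
by rewrite /tdown ifT ?tfloor_id//; exact/asboolP.
Qed.

Let measurable_fshift_le : measurable ([set t | sg t <= t] : set (measurableTypeR R)).
Proof.
have mle : measurable_fun (setT : set (measurableTypeR R)) (fun t : R => sg t <= t).
  apply: measurable_fun_ler; last exact: measurable_id.
  by apply: nondecreasing_measurable => //; exact: fshift_nd.
have := mle measurableT [set true] I; rewrite setTI.
by congr measurable; apply/seteqP; split => t /=.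
Qed.

Let measurable_ts : measurable (T : set (measurableTypeR R)).
Proof. by apply: closed_measurable; exact: hT.2. Qed.

Let lebesgue_setU1 (N : set (measurableTypeR R)) : measurable N -> la N = 0%E ->
  la (N `|` [set a]) = 0%E.
Proof.
move=> mN N0.
by rewrite [LHS]measureU0//; exact: lebesgue_measure_set1.
Qed.

Let restrict_psiE t : T t -> a <= t -> t < b ->
  (psi \_ `[a, b[%classic) t = fine (phi t).
Proof.
move=> Tt at_ tb.
rewrite patchE mem_set; last by rewrite /= in_itv/= at_.
rewrite /psi; congr (fine (phi _)).
rewrite /tdown ifT ?tfloor_id//; apply/asboolP.
by split; [exists t|exists b].
Qed.

Let gE v : T v -> a <= v -> v <= b -> g v = F v + g a.
Proof. by move=> *; rewrite -incrementF// subrK. Qed.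

Let derivative_of_F t : T t -> a <= t -> t < b ->
  derivable F t 1 /\ derive1 F t = (psi \_ `[a, b[%classic) t ->
  forall e, 0 < e -> \forall s \near t, T s -> a <= s -> s <= b ->
    `|g t - g s - fine (phi t) * (t - s)| <= e * `|t - s|.
Proof.
move=> Tt at_ tb [dF Ft] e e0.
have fE := restrict_psiE Tt at_ tb.
apply: filterS (derivable_near_linear dF (etrans Ft fE) e0) => s h Ts as_ sb.
have -> : g t - g s = F t - F s by rewrite (@gE t) ?(@gE s) ?(ltW tb)// opprD addrACA subrr addr0.
exact: h.
Qed.

(** Only right-dense points of N are excluded, because right-scattered points
carry positive mass and are covered by scattered_derivative. *)
Let exceptional (N : set (measurableTypeR R)) : set (measurableTypeR R) :=
  (`[a, b[%classic `\` T) `|` (`[a, b[%classic `&` (N `&` [set t | sg t <= t])).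

Let measurable_exceptional N : measurable N -> measurable (exceptional N).
Proof.
move=> mN; apply: measurableU.
  by apply: measurableD; [exact: measurable_itv|exact: measurable_ts].
apply: measurableI; first exact: measurable_itv.
by apply: measurableI => //; exact: measurable_fshift_le.
Qed.

(** Rounding down fixes any point that is sent to a right-dense point, and never
ends outside T; hence the preimage of the exceptional set lies in N. *)
Let exceptional0 N : measurable N -> la N = 0%E -> mu (exceptional N) = 0%E.
Proof.
move=> mN N0.
have mE := measurable_exceptional mN.
rewrite fshift_measureE//.
apply: (subset_measure0 _ mN) => //.
  apply: measurableI; first exact: measurable_tcore.
  by rewrite -[X in measurable X]setTI; apply: measurable_tdown.
move=> u [Du]; have [Td du maxu] := tdown_core hT Du.
move=> [[]//|[_ [N'd sd]]].
suff <- : tdown T u = u by [].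
apply/eqP; rewrite eq_le du/= leNgt; apply/negP => dlu.
have : u <= sg (tdown T u) by apply: (le_fshift_of_tdown_le hT Du).
by move=> /le_lt_trans; move=> /(_ _ (le_lt_trans sd dlu)); rewrite ltxx.
Qed.

(** The point a is added to the Lebesgue-null set: if right-dense, it has
measure zero, and if right-scattered, it is covered by the first alternative.
So a right-dense t may be assumed to be interior, with neighbours on both
sides in [a, b]. *)
Lemma delta_derivative_ae : {ae mu, forall t, a <= t -> t < b -> T t /\
  (t < sg t \/ [/\ sg t = t, a < t & forall e, 0 < e ->
     \forall s \near t, T s -> a <= s -> s <= b ->
       `|g t - g s - fine (phi t) * (t - s)| <= e * `|t - s|])}.
Proof.
have [N [mN N0 NF]] := FTC.
have mN' : measurable (N `|` [set a] : set (measurableTypeR R)) by exact: measurableU.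
exists (exceptional (N `|` [set a])); split.
- exact: measurable_exceptional.
- by apply: exceptional0 => //; exact: lebesgue_setU1.
move=> t /= /not_implyP[at_ /not_implyP[tb]] nt.
have [Tt|nTt] := pselect (T t); last first.
  by left; split => //=; rewrite in_itv/= at_.
right; split; first by rewrite /= in_itv/= at_.
have [tst|stt] := ltP t (sg t); first by exfalso; apply: nt; split => //; left.
split; last by [].
apply: contrapT => nN'; apply: nt; split => //; right.
have sgt : sg t = t.
  by apply/eqP; rewrite eq_le stt; have [] := fshift_gt_mem hT Tb tb.
have ta : t != a by apply: contra_notN nN' => /eqP ->; right.
split => //; first by rewrite lt_neqAle eq_sym ta.
apply: derivative_of_F => //.
by apply: contrapT => h; apply: nN'; left; apply: NF.
Qed.

End derivative.

(** * Complex-valued functions *)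

Lemma eq_bounded_variation (R : realType) (a b : R) (f g : R -> R) : a <= b ->
  {in `[a, b], f =1 g} -> bounded_variation a b f -> bounded_variation a b g.
Proof.
move=> ab fg [M ubM]; exists M => _ [s ps <-]; apply: ubM; exists s => //.
have I k : (k <= size s)%N -> nth b (a :: s) k \in `[a, b].
  by move=> ks; rewrite in_itv/= itv_partition_nth_ge ?itv_partition_nth_le.
apply: eq_big_nat => n /andP[_ ns].
have := fg _ (I n (ltnW ns)); have := fg _ (I n.+1 ns).
by rewrite /= => -> ->.
Qed.

Section complex_components.
Local Open Scope complex_scope.
Variable R : realType.
Implicit Types z w : R[i].

Lemma normc_ge_Re z : `|complex.Re z| <= Normc.normc z.
Proof.
by case: z => x y /=; rewrite -sqrtr_sqr ler_wsqrtr// lerDl sqr_ge0.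
Qed.

Lemma normc_ge_Im z : `|complex.Im z| <= Normc.normc z.
Proof.
by case: z => x y /=; rewrite -sqrtr_sqr ler_wsqrtr// lerDr sqr_ge0.
Qed.

Lemma normc_le_ReIm z : Normc.normc z <= `|complex.Re z| + `|complex.Im z|.
Proof.
case: z => x y /=; rewrite -[leRHS]ger0_norm ?addr_ge0// -sqrtr_sqr ler_wsqrtr//.
rewrite sqrrD -!normrX !(ger0_norm (sqr_ge0 _)) addrAC lerDl.
by rewrite mulrn_wge0// mulr_ge0.
Qed.

Lemma left_continuous_atP (F : R -> R[i]) t : left_continuous_at F t <->
  forall e, 0 < e -> \forall x \near t^'-, Normc.normc (F t - F x) <= e.
Proof.
split=> [/cvgrPdist_le h e e0|h].
  have /h : 0 < e%:C by rewrite ltcR.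
  by apply: filterS => x; rewrite -lecR.
apply/cvgrPdist_le => -[er ei]; rewrite ltcE/= => /andP[/eqP -> er0].
by apply: filterS (h _ er0) => x; rewrite -lecR.
Qed.

Lemma left_continuous_at_ReIm (F : R -> R[i]) t : left_continuous_at F t <->
  ((@complex.Re R \o F) x @[x --> t^'-] --> (@complex.Re R \o F) t) /\
  ((@complex.Im R \o F) x @[x --> t^'-] --> (@complex.Im R \o F) t).
Proof.
split=> [/left_continuous_atP h|[/cvgrPdist_le h1 /cvgrPdist_le h2]].
  split; apply/cvgrPdist_le => e e0; apply: filterS (h _ e0) => x; apply: le_trans.
    by apply: le_trans (normc_ge_Re _); rewrite /=; case: (F t) (F x) => ? ? [].
  by apply: le_trans (normc_ge_Im _); rewrite /=; case: (F t) (F x) => ? ? [].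
apply/left_continuous_atP => e e0; have e20 : 0 < e / 2 by rewrite divr_gt0.
apply: filterS2 (h1 _ e20) (h2 _ e20) => x /= h3 h4.
apply: le_trans (normc_le_ReIm _) _.
have : `|complex.Re (F t) - complex.Re (F x)| + `|complex.Im (F t) - complex.Im (F x)| <= e by lra.
by apply: le_trans; case: (F t) (F x) => ? ? [].
Qed.

End complex_components.

Lemma extensionE (R : realType) (T : set R) (f : R -> R[i]) t :
  extension T f t = f (tceil T t).
Proof. by rewrite /extension /tceil; case: asboolP. Qed.

Section components_of_extension.
Local Open Scope complex_scope.
Variables (R : realType) (T : set R).
Hypothesis hT : time_scale T.
Variables a b : R.
Hypotheses (Ta : T a) (Tb : T b) (ab : a < b).
Variable f : R -> R[i].
Local Notation sg := (fshift T).
Local Notation mu := (fshift_measure T).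
Local Notation c := (tround T a b).
Local Notation Re := (@complex.Re R).
Local Notation Im := (@complex.Im R).

Lemma clamp_extension x : clamp a b (extension T f) x = f (c x).
Proof. exact: extensionE. Qed.

Lemma extension_tround x : a <= x -> x <= b -> extension T f x = f (c x).
Proof. by move=> ax xb; rewrite extensionE tround_in. Qed.

Lemma delta_ac_ReIm : delta_abs_continuous T f a b <->
  real_delta_abs_continuous T (Re \o f) a b /\ real_delta_abs_continuous T (Im \o f) a b.
Proof.
split=> [ac|[acR acI] e e0].
  split=> e e0; have [d d0 H] := ac e e0; exists d => // n x y xy triv sd;
    apply: le_lt_trans (H n x y xy triv sd); apply: ler_sum => k _.
  - by apply: le_trans (normc_ge_Re _); rewrite /=; case: (f (y k)) (f (x k)) => ? ? [].
  - by apply: le_trans (normc_ge_Im _); rewrite /=; case: (f (y k)) (f (x k)) => ? ? [].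
have e20 : 0 < e / 2 by rewrite divr_gt0.
have [d d0 H] := acR _ e20; have [d' d'0 H'] := acI _ e20.
exists (Num.min d d'); first by rewrite lt_min d0.
move=> n x y xy triv; rewrite lt_min => /andP[sd sd'].
rewrite (splitr e); apply: le_lt_trans (ltrD (H n x y xy triv sd) (H' n x y xy triv sd')).
rewrite -big_split/=; apply: ler_sum => k _; apply: le_trans (normc_le_ReIm _) _.
by case: (f (y k)) (f (x k)) => ? ? [].
Qed.

Lemma left_continuous_extension t : a < t -> t <= b ->
  left_continuous_at (extension T f) t <->
  ((Re \o f \o c) x @[x --> t^'-] --> (Re \o f \o c) t) /\
  ((Im \o f \o c) x @[x --> t^'-] --> (Im \o f \o c) t).
Proof.
move=> at_ tb.
have E (p : R[i] -> R) : ((p \o extension T f) x @[x --> t^'-] --> (p \o extension T f) t) <->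
    ((p \o f \o c) x @[x --> t^'-] --> (p \o f \o c) t).
  have -> : (p \o f \o c) t = (p \o extension T f) t.
    by rewrite /= extension_tround// ltW.
  have eq : \forall x \near t^'-, (p \o f \o c) x = (p \o extension T f) x.
    near=> x; rewrite /= extension_tround//.
      by apply: ltW; near: x; exact: nbhs_left_gt.
    by apply: le_trans tb; near: x; exact: nbhs_left_le.
  split=> h; apply: cvg_trans h; apply: near_eq_cvg => //.
  by apply: filterS eq => x ->.
by rewrite left_continuous_at_ReIm !E.
Unshelve. all: by end_near. Qed.

Lemma stieltjes_extension (p : R[i] -> R) (nu : borel_charge R) :
  is_stieltjes_charge (p \o clamp a b (extension T f)) nu <->
  is_stieltjes_charge (p \o f \o c) nu.
Proof.
by have -> : p \o clamp a b (extension T f) = p \o f \o c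
  by apply/funext => x; rewrite /= clamp_extension.
Qed.

Lemma delta_ac_iff : delta_abs_continuous T f a b <->
  left_continuous_on (extension T f) a b /\ abs_continuous_fshift T (extension T f) a b.
Proof.
split=> [/delta_ac_ReIm[acR acI]|[lc [_ [nu [stR stI] [domR domI]]]]].
  split.
    move=> t at_ tb; apply/left_continuous_extension => //.
    by split; exact: (delta_ac_left_continuous hT Tb ab).
  have bv p : real_delta_abs_continuous T (p \o f) a b ->
      bounded_variation a b (p \o extension T f).
    move=> /(delta_ac_bv hT Ta Tb ab); apply: eq_bounded_variation => [|x]; first exact: ltW.
    by rewrite in_itv/= => /andP[ax xb]; rewrite /= extension_tround.
  split; first by split; exact: bv.
  have ex p : real_delta_abs_continuous T (p \o f) a b ->
      exists nu : borel_charge R, is_stieltjes_charge (p \o f \o c) nu.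
    move=> /(delta_ac_bv hT Ta Tb ab) h; apply: (bv_stieltjes_charge ab h) => x.
    by rewrite /= -tround_clamp.
  have [nR stR] := ex _ acR; have [nI stI] := ex _ acI.
  exists (nR, nI); first by split; apply/stieltjes_extension.
  by split; [exact: (delta_ac_dominates hT Ta Tb ab acR stR)|
    exact: (delta_ac_dominates hT Ta Tb ab acI stI)].
apply/delta_ac_ReIm.
have lcP t : a < t -> t <= b -> _ := fun h1 h2 => (left_continuous_extension h1 h2).1 (lc t h1 h2).
move/stieltjes_extension : stR => stR; move/stieltjes_extension : stI => stI.
split.
- by apply: (dominated_delta_ac hT Ta ab _ stR domR) => t h1 h2; case: (lcP t h1 h2).
- by apply: (dominated_delta_ac hT Ta ab _ stI domI) => t h1 h2; case: (lcP t h1 h2).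
Qed.

Lemma dense_delta_derivative (D : set R) t (l : R[i]) : D t -> sg t = t ->
  (forall p, p = Re \/ p = Im -> forall e, 0 < e -> \forall s \near t, D s ->
     `|p (f t) - p (f s) - p l * (t - s)| <= e * `|t - s|) ->
  is_delta_derivative_within T D f t l.
Proof.
move=> Dt sgt h; split => // e e0; rewrite sgt near_withinE.
have e20 : 0 < e / 2 by rewrite divr_gt0.
apply: filterS2 (h Re (or_introl erefl) _ e20) (h Im (or_intror erefl) _ e20).
move=> s h1 h2 Ds; apply: le_trans (normc_le_ReIm _) _.
rewrite (splitr e) mulrDl; apply: lerD.
- apply: le_trans (h1 Ds); rewrite le_eqVlt; apply/orP; left; apply/eqP; congr `|_|.
  by case: (f t) (f s) l {h h1 h2} => ? ? [? ?] [? ?] /=; rewrite mulr0 subr0.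
- apply: le_trans (h2 Ds); rewrite le_eqVlt; apply/orP; left; apply/eqP; congr `|_|.
  by case: (f t) (f s) l {h h1 h2} => ? ? [? ?] [? ?] /=; rewrite mulr0 add0r.
Qed.

(** As s tends to t the denominator sg t - s stays away from zero, so once l is the
exact slope across the gap, continuity of f at t along D suffices. To the right of t
there are no points of D nearby, and on the left continuity comes from the
extension, or is void. *)
Lemma scattered_delta_derivative (D : set R) t (l : R[i]) : D t -> T t -> t < sg t ->
  D `<=` T ->
  left_continuous_at (extension T f) t \/ (forall s, D s -> t <= s) ->
  f (sg t) - f t = l * (sg t - t)%:C ->
  is_delta_derivative_within T D f t l.
Proof.
move=> Dt Tt tst DT hl jump; split => // e e0.
have r0 : 0 < sg t - t by rewrite subr_gt0.
pose r := sg t - t.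
have er0 : 0 < e * r / 4 by rewrite divr_gt0// mulr_gt0.
have l0 : 0 <= Normc.normc l by rewrite -lecR; exact: (normr_ge0 l).
have cont : \forall s \near within D (nbhs t), Normc.normc (f t - f s) <= e * r / 4.
  rewrite near_withinE.
  have right_t s : D s -> s < sg t -> t <= s -> s = t.
    move=> Ds ss; rewrite le_eqVlt => /predU1P[//|ts].
    by have := fshift_le (DT _ Ds) ts; rewrite leNgt ss.
  have t0 : Normc.normc (f t - f t) <= e * r / 4.
    by rewrite subrr Normc.normc0 ltW.
  case: hl => [/left_continuous_atP/(_ _ er0)|tD].
    rewrite /at_left near_withinE; apply: filterS2; last exact: (lt_nbhsl tst).
    move=> s ss h Ds; have [ts|st] := leP t s; first by rewrite (right_t s).
    have := h st; rewrite !extensionE !tceil_id//; exact: DT.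
  near=> s => Ds; rewrite (right_t s)//; last exact: tD.
  by near: s; exact: lt_nbhsl.
have near_le d : 0 < d -> \forall s \near within D (nbhs t), `|t - s| <= d.
  move=> d0; rewrite near_withinE.
  have /cvgrPdist_le/(_ _ d0) : x @[x --> t] --> t by exact: cvg_id.
  by apply: filterS.
have l1 : 0 < Normc.normc l + 1 by rewrite ltr_wpDl.
near=> s.
have h1 : Normc.normc (f t - f s) <= e * r / 4 by near: s.
have h2 : `|t - s| <= r / 2 by near: s; apply: near_le; rewrite divr_gt0.
have h3 : Normc.normc l * `|t - s| <= e * r / 4.
  have : `|t - s| <= e * r / 4 / (Normc.normc l + 1).
    by near: s; apply: near_le; rewrite divr_gt0.
  by rewrite ler_pdivlMr// mulrC; apply: le_trans; rewrite ler_wpM2r// lerDl.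
have -> : f (sg t) - f s - l * (sg t - s)%:C = (f t - f s) + l * (s - t)%:C.
  have -> : f (sg t) = f t + l * (sg t - t)%:C by rewrite -jump subrKC.
  by rewrite !rmorphB/=; ring.
apply: le_trans (le_normcD _ _) _.
have -> : Normc.normc (l * (s - t)%:C) = Normc.normc l * `|t - s|.
  by rewrite Normc.normcM/= expr0n addr0 sqrtr_sqr distrC.
apply: le_trans (lerD h1 h3) _.
have -> : e * r / 4 + e * r / 4 = e * (r / 2) by field.
rewrite ler_pM2l//.
have : r <= `|sg t - s| + `|s - t|.
  by apply: le_trans (ler_normD _ _); rewrite addrA subrK; exact: ler_norm.
by rewrite (distrC s); lra.
Unshelve. all: by end_near. Qed.

End components_of_extension.

Theorem theorem3p3 (R : realType) (T : set R) (hT : time_scale T) (a b : R)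
    (f : R -> R[i]) (Ta : T a) (Tb : T b) (ab : a < b) :
  (delta_abs_continuous T f a b <->
     left_continuous_on (extension T f) a b /\
     abs_continuous_fshift T (extension T f) a b) /\
  (delta_abs_continuous T f a b ->
     forall nu : complex_charge R, is_assoc_measure a b (extension T f) nu ->
       {ae fshift_measure T, forall t : R, t \in `[a, b[ ->
          is_delta_derivative_within T (T `&` `[a, b]%classic) f t
            (RN_derivative T a b nu t) /\
          (a < t \/ left_continuous_at (extension T f) a ->
           is_delta_derivative T f t (RN_derivative T a b nu t))}).
Proof.
split; first exact: delta_ac_iff.
move=> ac nu [stR stI].
have [lc _] := (delta_ac_iff hT Ta Tb ab f).1 ac.
have [acR acI] := (delta_ac_ReIm T a b f).1 ac.
move/stieltjes_extension : stR => stR; move/stieltjes_extension : stI => stI.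
have domR := delta_ac_dominates hT Ta Tb ab acR stR.
have domI := delta_ac_dominates hT Ta Tb ab acI stI.
have lcR := delta_ac_left_continuous hT Tb ab acR.
have lcI := delta_ac_left_continuous hT Tb ab acI.
have aeR := delta_derivative_ae hT Ta Tb ab lcR stR domR.
have aeI := delta_derivative_ae hT Ta Tb ab lcI stI domI.
move: aeR aeI; apply: filterS2.
  exact: (ae_filter_ringOfSetsType (lebesgue_stieltjes_measure (fshift T))).
move=> t /= hR hI; rewrite in_itv/= => /andP[at_ tb].
have [Tt caseR] := hR at_ tb; have [_ caseI] := hI at_ tb.
have DT : T `&` `[a, b]%classic `<=` T by move=> s [].
have Dt : (T `&` `[a, b]%classic) t by split => //=; rewrite in_itv/= at_ ltW.
have [tst|stt] := ltP t (fshift T t).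
  have jump : f (fshift T t) - f t = RN_derivative T a b nu t * ((fshift T t - t)%:C)%C.
    have eR := scattered_derivative hT Ta Tb ab lcR stR domR Tt at_ tb tst.
    have eI := scattered_derivative hT Ta Tb ab lcI stI domI Tt at_ tb tst.
    rewrite /RN_derivative.
    move: eR eI => /=; case: (f (fshift T t)) (f t) => [x y] [x' y'] /= eR eI.
    by apply/eqP; rewrite eq_complex/= !mulr0 subr0 add0r eR eI !eqxx.
  split; last move=> h.
  - apply: scattered_delta_derivative => //.
    have [ta|a_lt_t] := leP t a; last by left; apply: lc => //; exact: ltW.
    by right=> s [_]; rewrite /= in_itv/= => /andP[+ _]; exact: le_trans.
  - apply: scattered_delta_derivative => //; left.
    have [ta|a_lt_t] := leP t a; last by apply: lc => //; exact: ltW.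
    case: h => [|h]; first by rewrite ltNge ta.
    by have -> : t = a by apply/eqP; rewrite eq_le ta.
have [|[sgt a_lt_t dR]] := caseR; first by rewrite ltNge stt.
have [|[_ _ dI]] := caseI; first by rewrite ltNge stt.
have near_ab : \forall s \near t, a <= s /\ s <= b.
  have : \forall s \near t, s \in `]a, b[ by apply: near_in_itvoo; rewrite in_itv/= a_lt_t.
  by apply: filterS => s; rewrite in_itv/= => /andP[/ltW + /ltW].
have dense (D : set R) : D t -> D `<=` T ->
    is_delta_derivative_within T D f t (RN_derivative T a b nu t).
  move=> {}Dt {}DT; apply: dense_delta_derivative => // p [->|->] e e0.
    apply: filterS2 near_ab (dR e e0) => s [as_ sb] h Ds.
    exact: h (DT _ Ds) as_ sb.
  apply: filterS2 near_ab (dI e e0) => s [as_ sb] h Ds.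
  exact: h (DT _ Ds) as_ sb.
by split => [|_]; exact: dense.
Qed.
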